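(* Let $E\subseteq\mathbb{Z}$. (i) Let $X$ be $L^p(\mathbb{T})$ with $1\le p<\infty$ not an even integer, or $X=\mathcal{C}(\mathbb{T})$. Then $E$ is a complex $1$-unconditional basic sequence in $X$ if and only if $E$ has at most two elements. (ii) If $p$ is an even integer, $p\ge 2$, then $E$ is a complex $1$-unconditional basic sequence in $L^p(\mathbb{T})$ if and only if $E$ is $p/2$-independent. Moreover there is a constant $C_p>1$ depending only on $p$ such that, for every $E\subseteq\mathbb{Z}$, either $E$ is a complex $1$-unconditional basic sequence in $L^p(\mathbb{T})$ or the complex unconditionality constant of $E$ in $L^p(\mathbb{T})$ is at least $C_p$.
   Context: $\mathbb{T}=\{z\in\mathbb{C}:|z|=1\}$ carries its normalized Haar measure $m$; $e_n(z)=z^n$ for $n\in\mathbb{Z}$. $L^p(\mathbb{T})$ and $\mathcal{C}(\mathbb{T})$ are the usual spaces of complex-valued functions with norms $\|f\|_p=(\int|f|^p\,dm)^{1/p}$ and $\|f\|_\infty$. Complex unconditionality constant of $E$ in $X$: the infimum of the constants $C$ (possibly $+\infty$) such that $\|\sum_{q\in G}\epsilon_q a_q e_q\|_X\le C\|\sum_{q\in G}a_qe_q\|_X$ for all finite $G\subseteq E$, all $a_q\in\mathbb{C}$ and all $\epsilon_q\in\mathbb{T}$. $E$ is a complex $1$-unconditional basic sequence in $X$ if this holds with $C=1$. $E$ is $n$-independent if every integer has at most one representation as a sum of $n$ elements of $E$ (repetitions allowed), up to permutation; i.e. for distinct $p_1,\dots,p_m\in E$ and $\alpha,\beta\in\mathbb{N}^m$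 with $\sum\alpha_i=\sum\beta_i=n$, $\sum\alpha_ip_i=\sum\beta_ip_i$ implies $\alpha=\beta$. *)

(* Defs.v *)
From HB Require Import structures.
From mathcomp Require Import all_boot all_order all_algebra finmap.
From mathcomp Require Import all_classical all_reals all_analysis.
From mathcomp Require Import measurable_realfun complex.
Import numFieldNormedType.Exports.
Import Order.TTheory GRing.Theory Num.Theory.
Import ComplexField.Normc.

Set Implicit Arguments.
Unset Strict Implicit.
Unset Printing Implicit Defensive.

Local Open Scope classical_set_scope.
Local Open Scope ring_scope.

(* [R[i]^o] rather than [R[i]] is what carries the norm topology. *)
Definition unit_circle (R : realType) : set R[i]^o := [set z | normc z = 1].

(* The compact group T, a subtype of the complex numbers, with the induced
   topology and its Borel sigma-algebra. *)
Definition circle (R : realType) : Type := set_type (@unit_circle R).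

HB.instance Definition _ (R : realType) := Topological.copy (circle R)
  (set_type (@unit_circle R)).

Definition cval (R : realType) (z : circle R) : R[i] := sval z.

Section expi.
Variable R : realType.

(* exp (2 i pi t) *)
Definition expi_val (t : R) : R[i]^o :=
  Complex (cos (2 * pi * t)) (sin (2 * pi * t)).

Lemma expi_val_unit (t : R) : expi_val t \in @unit_circle R.
Proof.
by rewrite inE /unit_circle /= /normc /expi_val cos2Dsin2 sqrtr1.
Qed.

Definition expi (t : measurableTypeR R) : circle R := exist _ (expi_val t) (expi_val_unit t).

HB.instance Definition _ := isPointed.Build (circle R) (expi 0).

HB.instance Definition _ := Measurable.copy (circle R)
  (g_sigma_algebraType (@open (circle R))).

Lemma continuous_expi_val : continuous expi_val.
Proof.
have cc : continuous (fun t : R => cos (2 * pi * t)).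
  move=> t; apply: (@continuous_comp _ _ _ ( *%R (2 * pi)) cos).
    exact: mulrl_continuous.
  exact: continuous_cos.
have cs : continuous (fun t : R => sin (2 * pi * t)).
  move=> t; apply: (@continuous_comp _ _ _ ( *%R (2 * pi)) sin).
    exact: mulrl_continuous.
  exact: continuous_sin.
move=> t; apply/cvgrPdist_lt => /= e e0.
have [/= Re_gt0 Im0] : 0 < complex.Re e /\ complex.Im e = 0.
  by move: e0; case: (e) => a b; rewrite ltcE /= => /andP[/eqP -> ->].
have d0 : 0 < complex.Re e / 2 by rewrite divr_gt0.
have /cvgrPdist_lt/(_ _ d0) nc := cc t.
have /cvgrPdist_lt/(_ _ d0) ns := cs t.
near=> s.
have h1 : `|cos (2 * pi * t) - cos (2 * pi * s)| < complex.Re e / 2.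
  by near: s.
have h2 : `|sin (2 * pi * t) - sin (2 * pi * s)| < complex.Re e / 2.
  by near: s.
rewrite normc_def ltcE /= Im0 eqxx /=.
apply: le_lt_trans (_ : `|cos (2 * pi * t) - cos (2 * pi * s)| +
    `|sin (2 * pi * t) - sin (2 * pi * s)| < _); last first.
  by rewrite [ltRHS](splitr (complex.Re e)) ltrD.
set u := cos _ - _; set v := sin _ - _.
rewrite -[leRHS]ger0_norm ?addr_ge0// -(sqrtr_sqr (`|u| + `|v|)) ler_wsqrtr//.
rewrite [leRHS]sqrrD !real_normK ?num_real// [leRHS]addrAC lerDl.
by rewrite mulrn_wge0// mulr_ge0.
Unshelve. all: by end_near. Qed.

Lemma measurable_expi :
  measurable_fun [set: measurableTypeR R] expi.
Proof.
apply: (@measurability _ _ (measurableTypeR R) (circle R) _ _ open erefl).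
move=> _ [_ [U oU <-] <-]; rewrite setTI.
apply: open_measurable.
rewrite (_ : _ @^-1` _ = expi_val @^-1` U) //.
by apply: open_comp => // t _; exact: continuous_expi_val.
Qed.

HB.instance Definition _ := @isMeasurableFun.Build _ _ (measurableTypeR R)
  (circle R) expi measurable_expi.

(* Normalized Haar measure m on T: the law of exp (2 i pi t) for t uniformly
   distributed in [0, 1]. *)
Definition haar : probability (circle R) R :=
  distribution (uniform_prob (@ltr01 R)) (expi : {mfun _ >-> _}).

End expi.

Section spaces.
Variable R : realType.
Implicit Types f : circle R -> R[i].

Definition Lp_norm (p : R) f : \bar R :=
  Lnorm (haar R) p%:E (fun z => (normc (f z))%:E).

(* the norm of C(T) *)
Definition sup_norm f : \bar R :=
  ereal_sup [set (normc (f z))%:E | z in [set: circle R]].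

Definition trig (q : int) : circle R -> R[i] := fun z => cval z ^ q.

Definition trig_sum (G : {fset int}) (a : int -> R[i]) : circle R -> R[i] :=
  fun z => \sum_(q <- G) a q * trig q z.

(* [N] is the norm of the space X under consideration. *)
Implicit Types (N : (circle R -> R[i]) -> \bar R) (E : set int).

Definition unconditional_with N E (C : R) : Prop :=
  forall (G : {fset int}) (a eps : int -> R[i]),
    [set` G] `<=` E ->
    (forall q, q \in G -> normc (eps q) = 1) ->
    (N (trig_sum G (fun q => eps q * a q)%R) <= C%:E * N (trig_sum G a))%E.

Definition one_unconditional N E : Prop := unconditional_with N E 1.

(* The infimum of the empty set is +oo.  The restriction 0 <= C only matters
   for E empty. *)
Definition unconditionality_constant N E : \bar R :=
  ereal_inf [set C%:E | C in [set C : R | 0 <= C /\ unconditional_with N E C]].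

End spaces.

Definition independent (n : nat) (E : set int) : Prop :=
  forall (m : nat) (p : 'I_m -> int) (alpha beta : 'I_m -> nat),
    injective p -> (forall i, E (p i)) ->
    (\sum_(i < m) alpha i)%N = n -> (\sum_(i < m) beta i)%N = n ->
    \sum_(i < m) p i *+ alpha i = \sum_(i < m) p i *+ beta i ->
    forall i, alpha i = beta i.

(* Main.v *)
(* For p = 2n, expanding f^n and applying Parseval writes ||f||_p^p as a sum
   over pairs of words of length n in the spectrum whose letters have the same
   sum.  If E is n-independent, the two words of each pair are permutations of
   each other, so the signs cancel.  Otherwise some letter occurs d times more
   often in one word of a pair than in the other; giving that letter a sign
   omega with omega^d = -1 lowers the value at f = sum of the e_q by at least 2,
   whereas this value is at most (2n)^(2n).  This yields the uniform gap.

   If p is not an even integer and p0 < p1 < p2 lie in E, let k be the length of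
   the shortest relation i p0 + j p2 = k p1 and take
   f = e_p1 + r (e_p0 + omega e_p2) with omega^j = -1.  With s = p / 2, Taylor's
   formula for |f|^p = (|f|^2)^s at 1 involves only the even moments of f of
   order at most 2k, up to O(r^(k+1)).  The set {p0, p1, p2} is l-independent for
   l < k, so only the k-th moment sees omega; its coefficient is nonzero because
   s is not a natural number, and the change is at least 2 r^k, a contradiction
   as r -> 0.  In C(T), a third element would force the three terms to be
   alignable for every choice of the signs. *)

Require Import Defs.
From mathcomp Require Import all_boot all_order all_algebra finmap.
From mathcomp Require Import all_classical all_reals all_analysis.
From mathcomp Require Import measurable_realfun complex.
From mathcomp Require Import ring lra zify.
Import numFieldNormedType.Exports.
Import Order.TTheory GRing.Theory Num.Theory.
Import ComplexField.Normc.

Set Implicit Arguments.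
Unset Strict Implicit.
Unset Printing Implicit Defensive.

Local Open Scope classical_set_scope.
Local Open Scope ring_scope.

(** * The exponential and unimodular numbers *)

Section exponential.
Variable R : realType.
Implicit Types (x y : R) (z : R[i]).

Lemma normc_ge0 z : 0 <= normc z.
Proof. by case: z => a b; exact: sqrtr_ge0. Qed.

Lemma normr_normc z : `|z| = (normc z)%:C%C.
Proof. by []. Qed.

Lemma normcX z n : normc (z ^+ n) = normc z ^+ n.
Proof. by apply: complexI; rewrite rmorphXn -!normr_normc normrX. Qed.

Lemma normc_exprz z (q : int) : normc (z ^ q) = normc z ^ q.
Proof.
by case: q => n; rewrite ?NegzE -?exprnP -?exprnN ?normcV normcX.
Qed.

Lemma normc_prod (I : Type) (s : seq I) (F : I -> R[i]) :
  normc (\prod_(i <- s) F i) = \prod_(i <- s) normc (F i).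
Proof.
elim: s => [|i s IH]; first by rewrite !big_nil normc1.
by rewrite !big_cons normcM IH.
Qed.

Lemma normc_sum (I : Type) (s : seq I) (F : I -> R[i]) :
  normc (\sum_(i <- s) F i) <= \sum_(i <- s) normc (F i).
Proof.
elim: s => [|i s IH]; first by rewrite !big_nil normc0.
rewrite !big_cons; apply: le_trans (le_normcD _ _) _.
by rewrite lerD2l.
Qed.

Lemma sqr_normc_Re z : normc z ^+ 2 = complex.Re (z * z^*%C).
Proof. by rewrite -sqr_normc normr_normc -rmorphXn. Qed.

Lemma Re_le_normc z : complex.Re z <= normc z.
Proof.
apply: le_trans (ler_norm _) _.
by have := normc_ge_Re z; rewrite normr_normc lecR.
Qed.

Lemma ReD z1 z2 : complex.Re (z1 + z2) = complex.Re z1 + complex.Re z2.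
Proof. by case: z1 z2 => a b [c d]. Qed.

Lemma Re_sum (I : Type) (s : seq I) (P : pred I) (F : I -> R[i]) :
  complex.Re (\sum_(i <- s | P i) F i) = \sum_(i <- s | P i) complex.Re (F i).
Proof. by apply: (big_morph _ ReD). Qed.

Definition cexpi x : R[i] := cval (expi x).

Lemma cexpiD x y : cexpi (x + y) = cexpi x * cexpi y.
Proof.
apply/eqP; rewrite eq_complex /= mulrDr cosD sinD.
by rewrite eqxx addrC [in X in _ && (X == _)]mulrC (mulrC (sin _)) eqxx.
Qed.

Lemma cexpi0 : cexpi 0 = 1.
Proof. by apply/eqP; rewrite eq_complex /= mulr0 cos0 sin0 !eqxx. Qed.

Lemma normc_cexpi x : normc (cexpi x) = 1.
Proof. by rewrite /normc /= cos2Dsin2 sqrtr1. Qed.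

Lemma unimodular_neq0 z : normc z = 1 -> z != 0.
Proof.
by apply: contra_eq_neq => ->; rewrite normc0 eq_sym oner_neq0.
Qed.

Lemma cexpi_neq0 x : cexpi x != 0.
Proof. exact/unimodular_neq0/normc_cexpi. Qed.

Lemma cexpi_half : cexpi (1 / 2) = - 1.
Proof.
apply/eqP; rewrite eq_complex /= (_ : 2 * pi * (1 / 2) = pi); last by field.
by rewrite cospi sinpi oppr0 !eqxx.
Qed.

Lemma cexpi_nat (n : nat) : cexpi n%:R = 1.
Proof.
have e1 : cexpi 1 = 1.
  by rewrite (splitr 1) cexpiD cexpi_half mulrNN mulr1.
elim: n => [|n IH]; first exact: cexpi0.
by rewrite -addn1 natrD cexpiD IH e1 mulr1.
Qed.

Lemma conjc_cexpi x : (cexpi x)^*%C = cexpi (- x).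
Proof. by apply/eqP; rewrite eq_complex /= mulrN cosN sinN !eqxx. Qed.

Lemma cexpiN x : cexpi (- x) = (cexpi x)^-1.
Proof.
by apply: (mulfI (cexpi_neq0 x)); rewrite -cexpiD subrr cexpi0 divff ?cexpi_neq0.
Qed.

Lemma cexpiX x (n : nat) : cexpi x ^+ n = cexpi (n%:R * x).
Proof.
elim: n => [|n IH]; first by rewrite mul0r cexpi0.
by rewrite exprS IH -cexpiD -(natr1 n) mulrDl mul1r addrC.
Qed.

Lemma cexpiXz x (q : int) : cexpi x ^ q = cexpi (q%:~R * x).
Proof.
case: q => n; first by rewrite -exprnP cexpiX.
by rewrite NegzE -exprnN cexpiX -cexpiN mulrNz mulNr.
Qed.

Lemma cexpi_int (q : int) : cexpi q%:~R = 1.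
Proof.
by rewrite -[q%:~R]mulr1 -cexpiXz (_ : 1 = 1%:R)// cexpi_nat exp1rz.
Qed.

Lemma cexpi_surj z : normc z = 1 -> exists x, z = cexpi x.
Proof.
case: z => a b n1.
have ab : a ^+ 2 + b ^+ 2 = 1.
  have := sqr_sqrtr (addr_ge0 (sqr_ge0 a) (sqr_ge0 b)).
  by move: n1 => /= ->; rewrite expr1n.
(* [acos] only reaches angles with nonnegative sine, so the sign of [b] decides between the angle
   and its opposite. *)
have a1 : -1 <= a <= 1 by apply/andP; split; have := sqr_ge0 b; nra.
have pi0 : (pi : R) != 0 by rewrite gt_eqF ?pi_gt0.
have cs : 2 * pi * (acos a / (2 * pi)) = acos a.
  by rewrite mulrC divfK// mulf_neq0// pnatr_eq0.
have sb : sin (acos a) = `|b|.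
  by rewrite sin_acos// -ab addrAC subrr add0r sqrtr_sqr.
have ca : cos (acos a) = a by rewrite acosK// in_itv.
case: (leP 0 b) => b0.
  exists (acos a / (2 * pi)).
  by apply/eqP; rewrite eq_complex /= cs ca sb ger0_norm// !eqxx.
exists (- (acos a / (2 * pi))).
apply/eqP; rewrite eq_complex /= mulrN cs cosN sinN ca sb ltr0_norm//.
by rewrite opprK !eqxx.
Qed.

Lemma normc_cval (u : circle R) : normc (cval u) = 1.
Proof. by have := set_valP u. Qed.

Lemma expi_surj (u : circle R) : exists x, u = expi x.
Proof.
have [x ux] := cexpi_surj (normc_cval u).
by exists x; apply/val_inj.
Qed.

Lemma conjcM z1 z2 : (z1 * z2)^*%C = z1^*%C * z2^*%C.
Proof. exact: rmorphM. Qed.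

Lemma conjcX z n : (z ^+ n)^*%C = z^*%C ^+ n.
Proof. exact: rmorphXn. Qed.

End exponential.

Arguments cexpi : simpl never.

(** * Means of trigonometric polynomials over a period *)

Section mean.
Variable R : realType.
Implicit Types (h g : R -> R).

Definition mean h : R := (\int[@lebesgue_measure R]_(t in `[0%R, 1%R]) h t)%R.

(** Bounded measurable functions are integrable over [[0, 1]] and stable under sums and products, so
    linearity of [mean] applies freely to them. *)
Definition tame h : Prop :=
  measurable_fun [set: measurableTypeR R] (h : measurableTypeR R -> R) /\
  exists M, forall t, `|h t| <= M.

Lemma tame_cst (c : R) : tame (fun=> c).
Proof. by split; [exact: measurable_cst|exists `|c|]. Qed.

Lemma tameD h g : tame h -> tame g -> tame (fun t => h t + g t).
Proof.
move=> [mh [M hM]] [mg [N gN]]; split; first exact: measurable_funD.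
by exists (M + N) => t; apply: le_trans (ler_normD _ _) _; exact: lerD.
Qed.

Lemma tameM h g : tame h -> tame g -> tame (fun t => h t * g t).
Proof.
move=> [mh [M hM]] [mg [N gN]]; split; first exact: measurable_funM.
by exists (M * N) => t; rewrite normrM ler_pM.
Qed.

Lemma tameX h n : tame h -> tame (fun t => h t ^+ n).
Proof.
move=> th; elim: n => [|n IH]; first exact: tame_cst.
by under eq_fun do rewrite exprS; exact: tameM.
Qed.

Lemma tame_sum (I : Type) (s : seq I) (P : pred I) (F : I -> R -> R) :
  (forall i, tame (F i)) -> tame (fun t => \sum_(i <- s | P i) F i t).
Proof.
move=> tF; elim: s => [|i s IH].
  by under eq_fun do rewrite big_nil; exact: tame_cst.
under eq_fun do rewrite big_cons.
by case: (P i) => //; exact: tameD.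
Qed.

Let m01 : @measurable _ (measurableTypeR R) `[0%R, 1%R].
Proof. exact: measurable_itv. Qed.

Lemma tame_integrable h : tame h ->
  (@lebesgue_measure R).-integrable `[0%R, 1%R] (EFin \o h).
Proof.
move=> [mh [M hM]]; apply: measurable_bounded_integrable => //.
- by rewrite /= lebesgue_measure_itv /= lte_fin ltr01 sube0 ltry.
- exact: measurable_funTS.
- exists M; split; rewrite ?num_real// => N MN t _ /=.
  by apply: le_trans (hM t) _; exact: ltW.
Qed.

Lemma eq_mean h g : (forall t, h t = g t) -> mean h = mean g.
Proof. by move=> hg; apply: eq_Rintegral => t _. Qed.

Lemma mean_cst (c : R) : mean (fun=> c) = c.
Proof.
rewrite /mean Rintegral_cst//= lebesgue_measure_itv /=.
by rewrite lte_fin ltr01 sube0 mulr1.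
Qed.

Lemma meanD h g : tame h -> tame g ->
  mean (fun t => h t + g t) = mean h + mean g.
Proof. by move=> th tg; rewrite /mean RintegralD//; exact: tame_integrable. Qed.

Lemma meanZ (c : R) h : tame h -> mean (fun t => c * h t) = c * mean h.
Proof. by move=> th; rewrite /mean RintegralZl//; exact: tame_integrable. Qed.

Lemma meanB h g : tame h -> tame g ->
  mean (fun t => h t - g t) = mean h - mean g.
Proof. by move=> th tg; rewrite /mean RintegralB//; exact: tame_integrable. Qed.

Lemma mean_sum (I : Type) (s : seq I) (P : pred I) (F : I -> R -> R) :
  (forall i, tame (F i)) ->
  mean (fun t => \sum_(i <- s | P i) F i t) = \sum_(i <- s | P i) mean (F i).
Proof.
move=> tF; elim: s => [|i s IH].
  by rewrite big_nil -[RHS]mean_cst; apply: eq_mean => t; rewrite big_nil.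
rewrite big_cons; case: ifPn => Pi.
  rewrite -IH -meanD//; last exact: tame_sum.
  by apply: eq_mean => t; rewrite big_cons Pi.
by rewrite -IH; apply: eq_mean => t; rewrite big_cons (negbTE Pi).
Qed.

Lemma ler_mean h g : tame h -> tame g -> (forall t, h t <= g t) ->
  mean h <= mean g.
Proof. by move=> th tg hg; apply: le_Rintegral => //; exact: tame_integrable. Qed.

Lemma mean_ge0 h : (forall t, 0 <= h t) -> 0 <= mean h.
Proof. by move=> h0; apply: Rintegral_ge0. Qed.

Lemma continuous_Re_cexpi (c : R[i]) (q : int) :
  continuous (fun t : R => complex.Re (c * cexpi (q%:~R * t)) : R).
Proof.
case: c => a b; pose w : R := 2 * pi * q%:~R.
have -> : (fun t : R => complex.Re (Complex a b * cexpi (q%:~R * t)) : R) =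
    (fun t : R => a * cos (w * t) - b * sin (w * t)).
  by apply/funext => t; rewrite /cexpi /= mulrA.
have cw (f : R -> R) (c : R) : continuous f -> continuous (fun t => c * f (w * t)).
  move=> cf t; apply: cvgMr; apply: (@continuous_comp _ _ _ ( *%R w) f).
    exact: mulrl_continuous.
  exact: cf.
by move=> t; apply: cvgB; apply: cw; [exact: continuous_cos|exact: continuous_sin].
Qed.

Lemma tame_Re_cexpi (c : R[i]) (q : int) :
  tame (fun t => complex.Re (c * cexpi (q%:~R * t))).
Proof.
split; first by apply: continuous_measurable_fun; exact: continuous_Re_cexpi.
exists (normc c) => t; have := normc_ge_Re (c * cexpi (q%:~R * t)).
by rewrite normr_normc normcM normc_cexpi mulr1 lecR.
Qed.

(** Orthogonality of the characters: for [q != 0] an explicit primitive takes the same value at 0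
    and at 1. Real parts keep all integrals real. *)
Lemma mean_Re_cexpi (c : R[i]) (q : int) :
  mean (fun t => complex.Re (c * cexpi (q%:~R * t))) =
  if q == 0 then complex.Re c else 0.
Proof.
case: eqVneq => [->|q0].
  by rewrite -[RHS]mean_cst; apply: eq_mean => t; rewrite mul0r cexpi0 mulr1.
case: c => a b.
pose w : R := 2 * pi * q%:~R.
have w0 : w != 0.
  by rewrite !mulf_neq0 ?pnatr_eq0 ?intr_eq0// gt_eqF// pi_gt0.
have dw (t : R) : is_derive t 1 ( *%R w : R -> R) w.
  have := is_deriveZ w (is_derive_id t (1 : R)).
  by move=> /is_derive_eq; apply; rewrite /GRing.scale /= mulr1.
have ds (t : R) := is_derive1_comp (is_derive_sin (w * t)) (dw t).
have dc (t : R) := is_derive1_comp (is_derive_cos (w * t)) (dw t).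
pose F : R -> R :=
  (a / w) \*: (sin \o *%R w : R -> R) + (b / w) \*: (cos \o *%R w : R -> R).
have dF (t : R) : is_derive t 1 F (a * cos (w * t) - b * sin (w * t)).
  have := is_deriveD (is_deriveZ (a / w) (ds t)) (is_deriveZ (b / w) (dc t)).
  move=> H; refine (is_derive_eq H _).
  by rewrite /GRing.scale /=; field.
have cF : continuous F.
  move=> t; apply: differentiable_continuous; apply/derivable1_diffP.
  by have [] := dF t.
rewrite /mean /Rintegral.
have -> : (\int[lebesgue_measure]_(t in `[0%R, 1%R])
    (complex.Re (Complex a b * cexpi (q%:~R * t)))%:E =
  (F 1)%:E - (F 0)%:E)%E.
  apply: continuous_FTC2 => //.
  - exact/continuous_subspaceT/continuous_Re_cexpi.
  - split.
    + by move=> t _; have [] := dF t.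
    + by apply: cvg_at_right_filter; exact: cF.
    + by apply: cvg_at_left_filter; exact: cF.
  - move=> t _; rewrite derive1E; have [_ ->] := dF t.
    by rewrite /= mulrA.
have Fv t : F t = a / w * sin (w * t) + b / w * cos (w * t) by [].
have /eqP := cexpi_int R q; rewrite eq_complex /= -/w => /andP[/eqP cw /eqP sw].
by rewrite /= !Fv mulr0 !mulr1 sin0 cos0 cw sw subrr.
Qed.

End mean.

(** * Even moments as sums over pairs of words *)

Section words.
Variable R : realType.
Implicit Types (n : nat) (G : {fset int}) (a : int -> R[i]).

(** A word of length [n] indexes one monomial of the expanded power [trig_sum G a ^+ n]: [wsum] is
    its frequency and [wprod] its coefficient. *)
Definition wsum n G (w : {ffun 'I_n -> G}) : int := \sum_j val (w j).

Definition wprod n G a (w : {ffun 'I_n -> G}) : R[i] := \prod_j a (val (w j)).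

Definition wcount n G (q : int) (w : {ffun 'I_n -> G}) : nat :=
  (\sum_j (val (w j) == q))%N.

Definition wterm n G a (u : {ffun 'I_n -> G} * {ffun 'I_n -> G}) : R :=
  complex.Re (wprod a u.1 * (wprod a u.2)^*%C).

(** This is the moment of order [2 * n] of the modulus of [trig_sum G a], in combinatorial form. *)
Definition wenergy n G a : R :=
  \sum_(u : {ffun 'I_n -> G} * {ffun 'I_n -> G} | wsum u.1 == wsum u.2)
    wterm a u.

Lemma trig_sum_expi G a (t : R) :
  trig_sum G a (expi t) = \sum_(q : G) a (val q) * cexpi ((val q)%:~R * t).
Proof.
rewrite /trig_sum big_seq_fsetE /=.
by apply: eq_bigr => q _; rewrite /trig -cexpiXz.
Qed.

Lemma trig_sumX_expi n G a (t : R) : trig_sum G a (expi t) ^+ n =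
  \sum_(w : {ffun 'I_n -> G}) wprod a w * cexpi ((wsum w)%:~R * t).
Proof.
rewrite -[in LHS](card_ord n) -prodr_const trig_sum_expi bigA_distr_bigA /=.
apply: eq_bigr => w _; rewrite big_split /=; congr (_ * _).
rewrite /wsum rmorph_sum mulr_suml.
by rewrite (big_morph (@cexpi R) (@cexpiD R) (@cexpi0 R)).
Qed.

(** The power is the product of [trig_sum G a ^+ n] with its conjugate; conjugation negates the
    frequency of the second word. *)
Lemma normc_trig_sumX n G a (t : R) : normc (trig_sum G a (expi t)) ^+ (2 * n) =
  \sum_(u : {ffun 'I_n -> G} * {ffun 'I_n -> G})
    complex.Re (wprod a u.1 * (wprod a u.2)^*%C *
                cexpi ((wsum u.1 - wsum u.2)%:~R * t)).
Proof.
rewrite mulnC exprM -normcX sqr_normc_Re trig_sumX_expi rmorph_sum /=.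
rewrite mulr_suml -(pair_bigA _ (fun w1 w2 =>
  complex.Re (wprod a w1 * (wprod a w2)^*%C *
    cexpi ((wsum w1 - wsum w2)%:~R * t)))) /= Re_sum.
apply: eq_bigr => w1 _; rewrite mulr_sumr Re_sum.
apply: eq_bigr => w2 _; rewrite conjcM conjc_cexpi.
by rewrite mulrACA -cexpiD rmorphB /= mulrBl.
Qed.

Lemma tame_normc_trig_sumX n G a :
  tame (fun t => normc (trig_sum G a (expi t)) ^+ (2 * n)).
Proof.
under eq_fun do rewrite normc_trig_sumX.
by apply: tame_sum => u; exact: tame_Re_cexpi.
Qed.

(** Parseval: only the pairs of words with equal frequency survive the mean. *)
Lemma mean_normc_trig_sumX n G a :
  mean (fun t => normc (trig_sum G a (expi t)) ^+ (2 * n)) = wenergy n G a.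
Proof.
under eq_mean do rewrite normc_trig_sumX.
rewrite mean_sum; last by move=> u; exact: tame_Re_cexpi.
under eq_bigr do rewrite mean_Re_cexpi subr_eq0.
by rewrite -big_mkcond.
Qed.

Lemma wprodM n G a b (w : {ffun 'I_n -> G}) :
  wprod (fun q => a q * b q) w = wprod a w * wprod b w.
Proof. exact: big_split. Qed.

Lemma wprod_perm n G a (w1 w2 : {ffun 'I_n -> G}) :
  perm_eq [seq val (w1 j) | j <- enum 'I_n] [seq val (w2 j) | j <- enum 'I_n] ->
  wprod a w1 = wprod a w2.
Proof.
move=> w12; rewrite /wprod.
have E (w : {ffun 'I_n -> G}) : \prod_j a (val (w j)) =
    \prod_(q <- [seq val (w j) | j <- enum 'I_n]) a q.
  by rewrite big_map enumT.
by rewrite !E; exact: perm_big.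
Qed.

Lemma normc_wprod n G a (w : {ffun 'I_n -> G}) :
  (forall q, q \in G -> normc (a q) = 1) -> normc (wprod a w) = 1.
Proof.
move=> a1; rewrite normc_prod big1// => j _; apply: a1; exact: valP.
Qed.

(** This restates [independent] with lists in place of multiplicities, which fits words directly;
    the equivalence is proved below. *)
Definition unique_sums n (E : set int) : Prop := forall s1 s2 : seq int,
  size s1 = n -> size s2 = n ->
  {in s1, forall q, E q} -> {in s2, forall q, E q} ->
  \sum_(q <- s1) q = \sum_(q <- s2) q -> perm_eq s1 s2.

(** The two words of a contributing pair are permutations of each other, so [eps] enters only
    through the squared modulus of one product, which is 1. *)
Lemma wenergy_unimodular n (E : set int) G a eps :
  unique_sums n E -> [set` G] `<=` E ->
  (forall q, q \in G -> normc (eps q) = 1) ->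
  wenergy n G (fun q => eps q * a q) = wenergy n G a.
Proof.
move=> fE GE eps1; apply: eq_bigr => -[w1 w2] /= /eqP w12.
have sumE (w : {ffun 'I_n -> G}) :
    \sum_(q <- [seq val (w j) | j <- enum 'I_n]) q = wsum w.
  by rewrite big_map enumT.
have szE (w : {ffun 'I_n -> G}) : size [seq val (w j) | j <- enum 'I_n] = n.
  by rewrite size_map size_enum_ord.
have inE' (w : {ffun 'I_n -> G}) :
    {in [seq val (w j) | j <- enum 'I_n], forall q, E q}.
  by move=> q /mapP[j _ ->]; apply: GE; exact: valP.
have w12E : perm_eq [seq val (w1 j) | j <- enum 'I_n]
    [seq val (w2 j) | j <- enum 'I_n].
  by apply: fE => //; rewrite !sumE.
rewrite /wterm /= !wprodM conjcM mulrACA -(wprod_perm eps w12E).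
by rewrite -sqr_normc normr_normc normc_wprod// expr1n mul1r.
Qed.

Lemma wprod_one_letter n G a om q0 (w : {ffun 'I_n -> G}) :
  wprod (fun q => (if q == q0 then om else 1) * a q) w =
  om ^+ wcount q0 w * wprod a w.
Proof.
rewrite wprodM; congr (_ * _).
rewrite /wprod /wcount.
rewrite (big_morph (fun k => om ^+ k) (exprD om) (expr0 om)) /=.
by apply: eq_bigr => j _; case: eqP.
Qed.

(* Every pair of words contributes at most its contribution at om = 1, and the
   pair u loses twice that contribution because om ^ d = -1. *)
Lemma wenergy_drop n G a om q0 (d : nat)
    (u : {ffun 'I_n -> G} * {ffun 'I_n -> G}) :
  (forall q, q \in G -> 0 <= a q) -> normc om = 1 -> om ^+ d = -1 ->
  wsum u.1 = wsum u.2 -> wcount q0 u.1 = (wcount q0 u.2 + d)%N ->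
  wenergy n G (fun q => (if q == q0 then om else 1) * a q) <=
  wenergy n G a - 2 * wterm a u.
Proof.
move=> a0 om1 omd us uc.
have wp0 (w : {ffun 'I_n -> G}) : 0 <= wprod a w.
  by apply: prodr_ge0 => j _; apply: a0; exact: valP.
have omJ : om * om^*%C = 1 by rewrite -sqr_normc normr_normc om1 expr1n.
have conjw (w : {ffun 'I_n -> G}) : (wprod a w)^*%C = wprod a w.
  by rewrite -[wprod a w]RRe_real ?ger0_real// conjc_real.
rewrite /wenergy (bigD1 u) /=; last by rewrite us.
rewrite [in leRHS](bigD1 u) /=; last by rewrite us.
rewrite addrAC lerD//.
  rewrite {1}/wterm !wprod_one_letter conjcM conjcX mulrACA uc exprD omd.
  rewrite [_ * -1 * _]mulrAC -exprMn omJ expr1n mul1r mulN1r /wterm.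
  by case: (_ * _) => x y /=; lra.
apply: ler_sum => -[w1 w2] /= _; rewrite /wterm /= !wprod_one_letter.
rewrite conjcM mulrACA conjw.
have : 0 <= wprod a w1 * wprod a w2 by rewrite mulr_ge0.
set x := wprod a w1 * _ => x0.
apply: le_trans (Re_le_normc _) _.
rewrite normcM normcM conjcX !normcX.
have -> : normc om^*%C = 1.
  by apply: complexI; rewrite -normr_normc normcJ normr_normc om1.
rewrite om1 !expr1n !mul1r.
by have := ger0_norm x0; rewrite normr_normc => xE; rewrite -{2}xE.
Qed.

End words.

(** * Independence as uniqueness of sums of lists *)

Lemma sum_count_mem (T : eqType) (V : nmodType) (f : T -> V) (u s : seq T) :
  uniq u -> {subset s <= u} ->
  \sum_(x <- u) f x *+ count_mem x s = \sum_(y <- s) f y.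
Proof.
move=> uu; elim: s => [|y s IH] su.
  by rewrite big_nil big1// => x _; rewrite mulr0n.
rewrite big_cons -IH; last by move=> z zs; apply: su; rewrite inE zs orbT.
under eq_bigr do rewrite /= mulrnDr.
rewrite big_split /=; congr (_ + _).
rewrite (bigD1_seq y) ?su ?mem_head//= eqxx mulr1n big1 ?addr0// => x.
by rewrite eq_sym => /negbTE ->; rewrite mulr0n.
Qed.

Lemma independent_unique_sums (n : nat) (E : set int) :
  independent n E -> unique_sums n E.
Proof.
move=> iE s1 s2 n1 n2 s1E s2E s12.
(* The distinct letters of both lists form the injective family, and their multiplicities in [s1]
   and [s2] the two coefficient vectors. *)
pose u := undup (s1 ++ s2).
have uu : uniq u by exact: undup_uniq.
have us1 : {subset s1 <= u} by move=> x xs; rewrite mem_undup mem_cat xs.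
have us2 : {subset s2 <= u} by move=> x xs; rewrite mem_undup mem_cat xs orbT.
pose p (i : 'I_(size u)) : int := nth 0 u i.
have sumE (V : nmodType) (f : int -> V) (s : seq int) : {subset s <= u} ->
    \sum_(i < size u) f (p i) *+ count_mem (p i) s = \sum_(x <- s) f x.
  move=> su; rewrite -(sum_count_mem f uu su) (big_nth 0) big_mkord.
  exact: eq_bigr.
have cntE (s : seq int) : {subset s <= u} ->
    (\sum_(i < size u) count_mem (p i) s)%N = size s.
  move=> su; rewrite -[RHS]sum1_size -(sumE _ (fun=> 1%N) s su).
  by apply: eq_bigr => i _; rewrite -[RHS]/(GRing.natmul 1 _) natn.
have pI : injective p.
  move=> i j /eqP; rewrite /p nth_uniq// => /eqP ij; exact: val_inj.
have pE i : E (p i).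
  have : p i \in u by exact: mem_nth.
  by rewrite mem_undup mem_cat => /orP[/s1E|/s2E].
have H := iE _ p (fun i => count_mem (p i) s1) (fun i => count_mem (p i) s2) pI pE.
rewrite !cntE// !(sumE _ id)// in H.
have {}H := H n1 n2 s12.
apply/allP => x xs /=.
have xu : (index x u < size u)%N by rewrite index_mem mem_undup.
have := H (Ordinal xu); rewrite /p /= nth_index ?mem_undup// => ->.
exact: eqxx.
Qed.

(** Each coefficient vector is unfolded into a list repeating [p i] as often as prescribed;
    injectivity of [p] lets counting recover the coefficients. *)
Lemma unique_sums_independent (n : nat) (E : set int) :
  unique_sums n E -> independent n E.
Proof.
move=> fE m p alpha beta pI pE an bn ab i.
pose s (c : 'I_m -> nat) := flatten [seq nseq (c i) (p i) | i <- enum 'I_m].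
have sumE (V : nmodType) (f : int -> V) c :
    \sum_(x <- s c) f x = \sum_(i < m) f (p i) *+ c i.
  rewrite /s big_flatten big_map enumT; apply: eq_bigr => j _.
  by rewrite big_nseq; elim: (c j) => [|k IH]; rewrite ?mulr0n// mulrS -IH.
have sz c : size (s c) = (\sum_(i < m) c i)%N.
  rewrite -sum1_size (sumE _ (fun=> 1%N)).
  by apply: eq_bigr => j _; rewrite -[LHS]/(GRing.natmul 1 _) natn.
have sE c : {in s c, forall q, E q}.
  move=> q /flattenP[t /mapP[j _ ->]].
  by rewrite mem_nseq => /andP[_ /eqP ->].
have cnt c j : count_mem (p j) (s c) = c j.
  rewrite -sum1_count big_mkcond /= (sumE _ (fun x => if x == p j then 1%N else 0%N)).
  rewrite (bigD1 j)//= eqxx big1 ?addr0.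
    by rewrite -[LHS]/(GRing.natmul 1 _) natn.
  by move=> k kj; rewrite (inj_eq pI) (negbTE kj) mul0rn.
have /permP/(_ (pred1 (p i))) : perm_eq (s alpha) (s beta).
  by apply: fE; rewrite ?sz// ?(sumE _ id)//; exact: sE.
by rewrite !cnt.
Qed.

Lemma word_of_seq (R : realType) (n : nat) (G : {fset int}) (s : seq int) :
  size s = n -> {in s, forall q, q \in G} ->
  exists w : {ffun 'I_n -> G},
    [/\ wsum w = \sum_(q <- s) q, forall q, wcount q w = count_mem q s
      & forall a : int -> R[i], wprod a w = \prod_(q <- s) a q].
Proof.
move=> sn sG.
have inG (j : 'I_n) : nth 0 s j \in G by apply: sG; rewrite mem_nth ?sn.
exists [ffun j => FSetSub (inG j)]; split.
- by rewrite /wsum (big_nth 0) big_mkord sn; apply: eq_bigr => j _; rewrite ffunE.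
- move=> q; rewrite /wcount -sum1_count (big_nth 0) big_mkord sn [RHS]big_mkcond /=.
  by apply: eq_bigr => j _; rewrite ffunE /=; case: eqP.
- move=> a; rewrite /wprod (big_nth 0) big_mkord sn.
  by apply: eq_bigr => j _; rewrite ffunE.
Qed.

Lemma root_of_opp1 (R : realType) (d : nat) : (0 < d)%N ->
  exists2 om : R[i], normc om = 1 & om ^+ d = -1.
Proof.
move=> d0; exists (cexpi (1 / 2 / d%:R)); first exact: normc_cexpi.
by rewrite cexpiX mulrC divfK ?cexpi_half// pnatr_eq0 -lt0n.
Qed.

(** * The drop in the even moment when sums are not unique *)

Section not_unique_sums.
Variable R : realType.

(** With unit coefficients the energy counts pairs of words with equal sums, and there are at most
    that many pairs in all. *)
Lemma wenergy1_le (n : nat) (G : {fset int}) :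
  wenergy n G (fun=> 1 : R[i]) <= ((#|` G| ^ (2 * n))%N)%:R.
Proof.
rewrite /wenergy.
have wt1 (u : {ffun 'I_n -> G} * {ffun 'I_n -> G}) : wterm (fun=> 1 : R[i]) u = 1.
  by rewrite /wterm /wprod !big1// mul1r conjc1.
under eq_bigr do rewrite wt1.
rewrite big_mkcond /=.
apply: (@le_trans _ _ (\sum_(u : {ffun 'I_n -> G} * {ffun 'I_n -> G}) 1)).
  by apply: ler_sum => u _; case: ifP.
rewrite sumr_const card_prod card_ffun card_ord cardfE.
by rewrite mulnC expnM -mulnn.
Qed.

Lemma not_unique_sums_drop (n : nat) (E : set int) : ~ unique_sums n E ->
  exists (G : {fset int}) (eps : int -> R[i]),
    [/\ [set` G] `<=` E, forall q, q \in G -> normc (eps q) = 1,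
      wenergy n G (fun q => eps q * 1) <= wenergy n G (fun=> 1 : R[i]) - 2
      & wenergy n G (fun=> 1 : R[i]) <= (((2 * n) ^ (2 * n))%N)%:R].
Proof.
move=> nf.
have [s1 [s2 [q0 [d [[n1 n2 s1E s2E s12] [d0 qd]]]]]] : exists s1 s2 q0 d,
    [/\ size s1 = n, size s2 = n, {in s1, forall q, E q}, {in s2, forall q, E q}
      & \sum_(q <- s1) q = \sum_(q <- s2) q] /\
    ((0 < d)%N /\ count_mem q0 s1 = (count_mem q0 s2 + d)%N).
  (* If no letter had different multiplicities the lists would be permutations; exchanging the lists
     makes the difference [d] positive. *)
  apply: contrapT => H; apply: nf => s1 s2 n1 n2 s1E s2E s12.
  apply/allP => q _ /=; apply/eqP.
  have [lt12|lt21|//] := ltngtP (count_mem q s1) (count_mem q s2); exfalso; apply: H.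
    exists s2, s1, q, (count_mem q s2 - count_mem q s1)%N; split; first by split.
    by rewrite subn_gt0 lt12 subnKC// ltnW.
  exists s1, s2, q, (count_mem q s1 - count_mem q s2)%N; split; first by split.
  by rewrite subn_gt0 lt21 subnKC// ltnW.
pose G : {fset int} := seq_fset tt (s1 ++ s2).
have sG1 : {in s1, forall q, q \in G}.
  by move=> q qs; rewrite /G seq_fsetE mem_cat qs.
have sG2 : {in s2, forall q, q \in G}.
  by move=> q qs; rewrite /G seq_fsetE mem_cat qs orbT.
have [w1 [w1s w1c w1p]] := word_of_seq R n1 sG1.
have [w2 [w2s w2c w2p]] := word_of_seq R n2 sG2.
have [om om1 omd] := root_of_opp1 R d0.
exists G, (fun q => if q == q0 then om else 1); split.
- move=> q /=; rewrite /G seq_fsetE mem_cat => /orP[/s1E|/s2E]//.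
- by move=> q _; case: ifP => // _; exact: normc1.
- have := @wenergy_drop R n G (fun=> 1) om q0 d (w1, w2).
  rewrite /wterm /= w1p w2p !big1// mul1r conjc1 mulr1.
  by apply => //; rewrite /= ?w1s ?w2s// w1c w2c.
(* At most [2 * n] letters occur in the two lists, so the bound does not depend on [E]. *)
- apply: le_trans (wenergy1_le _ _) _; rewrite ler_nat.
  have [-> //|n0] := eqVneq n 0%N.
  rewrite leq_exp2r; last by rewrite muln_gt0 /= lt0n.
  have -> : (2 * n)%N = size (s1 ++ s2) by rewrite size_cat n1 n2 mul2n addnn.
  by rewrite size_seq_fset size_undup.
Qed.

End not_unique_sums.

(** * The norms as means *)

Section measurability.
Variable R : realType.

Definition cmeasurable (h : circle R -> R[i]) : Prop :=
  measurable_fun [set: circle R] (fun z => complex.Re (h z)) /\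
  measurable_fun [set: circle R] (fun z => complex.Im (h z)).

(** Preimages of open intervals are open, hence generators of the sigma-algebra of the circle. *)
Lemma continuous_measurable_circle (h : circle R -> R) :
  continuous h -> measurable_fun [set: circle R] h.
Proof.
move=> ch; apply: (measurability _ (RGenOpens.measurableE R)).
move=> _ [_ [a [b ->] <-]]; rewrite setTI.
apply: sub_sigma_algebra; rewrite /=.
by apply: open_comp => // z _; exact: ch.
Qed.

Lemma continuous_cval : continuous (@cval R : circle R -> R[i]^o).
Proof. exact: initial_continuous. Qed.

Lemma continuous_Re : continuous (fun z : R[i]^o => complex.Re z : R).
Proof.
move=> z; apply: (iffRL (@cvgrPdist_lt _ _ _ _ (nbhs_filter (z : R[i]^o)) _ _)).
move=> e e0 /=.
(* The norm of [R[i]] takes its values in [R[i]], so the radius has to be embedded there. *)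
have e0' : 0 < e%:C%C by rewrite ltcR.
apply: filterS (nbhsx_ballx (z : R[i]^o) _ e0') => w.
rewrite -ball_normE /= -[X in is_true X -> _]/(`|z - w| < e%:C%C) -ltcR.
apply: le_lt_trans; apply: le_trans (normc_ge_Re _).
by case: z w => ? ? [].
Qed.

Lemma continuous_Im : continuous (fun z : R[i]^o => complex.Im z : R).
Proof.
move=> z; apply: (iffRL (@cvgrPdist_lt _ _ _ _ (nbhs_filter (z : R[i]^o)) _ _)).
move=> e e0 /=.
have e0' : 0 < e%:C%C by rewrite ltcR.
apply: filterS (nbhsx_ballx (z : R[i]^o) _ e0') => w.
rewrite -ball_normE /= -[X in is_true X -> _]/(`|z - w| < e%:C%C) -ltcR.
apply: le_lt_trans.
(* Multiplication by the imaginary unit turns the imaginary part into a real part, up to sign. *)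
have := normc_ge_Re ((z - w) * 'i%C).
rewrite ReiNIm normrN normrM complexiE normCi mulr1.
by apply: le_trans; case: z w => ? ? [].
Qed.

Lemma cmeasurable_cst (c : R[i]) : cmeasurable (fun=> c).
Proof. by split; exact: measurable_cst. Qed.

Lemma cmeasurable_cval : cmeasurable (@cval R).
Proof.
split; apply: continuous_measurable_circle.
  by move=> z; apply: continuous_comp; [exact: continuous_cval|exact: continuous_Re].
by move=> z; apply: continuous_comp; [exact: continuous_cval|exact: continuous_Im].
Qed.

Lemma cmeasurableD f g : cmeasurable f -> cmeasurable g ->
  cmeasurable (fun z => f z + g z).
Proof.
move=> [fr fi] [gr gi]; split.
  rewrite (_ : (fun _ => _) = (fun z => complex.Re (f z) + complex.Re (g z))).
    exact: measurable_funD.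
  by apply/funext => z; case: (f z) (g z) => ? ? [].
rewrite (_ : (fun _ => _) = (fun z => complex.Im (f z) + complex.Im (g z))).
  exact: measurable_funD.
by apply/funext => z; case: (f z) (g z) => ? ? [].
Qed.

Lemma cmeasurableM f g : cmeasurable f -> cmeasurable g ->
  cmeasurable (fun z => f z * g z).
Proof.
move=> [fr fi] [gr gi]; split.
  rewrite (_ : (fun _ => _) = (fun z => complex.Re (f z) * complex.Re (g z) -
      complex.Im (f z) * complex.Im (g z))).
    by apply: measurable_funB; exact: measurable_funM.
  by apply/funext => z; case: (f z) (g z) => ? ? [].
rewrite (_ : (fun _ => _) = (fun z => complex.Re (f z) * complex.Im (g z) +
    complex.Im (f z) * complex.Re (g z))).
  by apply: measurable_funD; exact: measurable_funM.
by apply/funext => z; case: (f z) (g z) => ? ? [].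
Qed.

Lemma cmeasurable_conj f : cmeasurable f -> cmeasurable (fun z => (f z)^*%C).
Proof.
move=> [fr fi]; split.
  rewrite (_ : (fun _ => _) = (fun z => complex.Re (f z)))//.
  by apply/funext => z; case: (f z).
rewrite (_ : (fun _ => _) = (fun z => - complex.Im (f z))).
  exact: measurable_funN.
by apply/funext => z; case: (f z).
Qed.

Lemma cmeasurableX f n : cmeasurable f -> cmeasurable (fun z => f z ^+ n).
Proof.
move=> mf; elim: n => [|n IH]; first exact: cmeasurable_cst.
by under eq_fun do rewrite exprS; exact: cmeasurableM.
Qed.

(** On the circle the inverse is the conjugate, so negative powers are powers of the conjugate. *)
Lemma cmeasurable_trig q : cmeasurable (@trig R q).
Proof.
have cK (z : circle R) : (cval z)^-1 = (cval z)^*%C.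
  by rewrite invc_norm normr_normc normc_cval expr1n invr1 mul1r.
rewrite /trig; case: q => n; first by exact/cmeasurableX/cmeasurable_cval.
under eq_fun do rewrite NegzE -exprnN -exprVn cK.
exact/cmeasurableX/cmeasurable_conj/cmeasurable_cval.
Qed.

Lemma cmeasurable_trig_sum G a : cmeasurable (@trig_sum R G a).
Proof.
rewrite /trig_sum; elim: (enum_fset G) => [|q s IH].
  by under eq_fun do rewrite big_nil; exact: cmeasurable_cst.
under eq_fun do rewrite big_cons.
apply: cmeasurableD => //; apply: cmeasurableM (cmeasurable_trig q).
exact: cmeasurable_cst.
Qed.

Lemma measurable_normc_trig_sum G a :
  measurable_fun [set: circle R] (fun z => normc (trig_sum G a z)).
Proof.
have [mr mi] := cmeasurable_trig_sum G a.
rewrite (_ : (fun _ => _) = (fun z => Num.sqrt (complex.Re (trig_sum G a z) ^+ 2 +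
   complex.Im (trig_sum G a z) ^+ 2))); last first.
  by apply/funext => z; case: (trig_sum G a z).
apply: measurableT_comp; first exact: continuous_measurable_fun (@sqrt_continuous R).
by apply: measurable_funD; apply: measurable_funX.
Qed.

Lemma normc_trig_sum_le G (a : int -> R[i]) z :
  normc (trig_sum G a z) <= \sum_(q <- G) normc (a q).
Proof.
apply: le_trans (normc_sum _ _) _; apply: ler_sum => q _.
by rewrite normcM /trig normc_exprz normc_cval exp1rz mulr1.
Qed.

Lemma tame_powR_trig_sum p G (a : int -> R[i]) : 0 <= p ->
  tame (fun t => normc (trig_sum G a (expi t)) `^ p).
Proof.
move=> p0; split.
  apply: (measurableT_comp (measurable_powR p)).
  apply: (measurableT_comp (measurable_normc_trig_sum G a)).
  exact: measurable_expi.
exists ((\sum_(q <- G) normc (a q)) `^ p) => t.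
rewrite ger0_norm ?powR_ge0// ge0_ler_powR// ?nnegrE ?normc_ge0//.
  by apply: sumr_ge0 => q _; exact: normc_ge0.
exact: normc_trig_sum_le.
Qed.

(** Haar measure is the image under [expi] of the uniform law on [[0, 1]]; boundedness makes the
    integral finite, hence a real mean. *)
Lemma Lp_norm_trig_sum p G (a : int -> R[i]) : 0 < p ->
  Lp_norm p (trig_sum G a) =
  ((mean (fun t => normc (trig_sum G a (expi t)) `^ p)) `^ p^-1)%:E.
Proof.
move=> p0; rewrite /Lp_norm unlock.
have mf : measurable_fun [set: circle R]
    (fun z => ((normc (trig_sum G a z)) `^ p)%:E).
  apply/measurable_EFinP; apply: (measurableT_comp (measurable_powR p)).
  exact: measurable_normc_trig_sum.
under eq_integral => z _.
  rewrite /= ger0_norm ?normc_ge0//.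
  over.
rewrite /haar ge0_integral_distribution//; last first.
  by move=> z; rewrite lee_fin powR_ge0.
have mg : measurable_fun [set: measurableTypeR R]
    ((fun z => ((normc (trig_sum G a z)) `^ p)%:E) \o expi (R := R)).
  by apply: measurableT_comp mf _; exact: measurable_expi.
rewrite (integral_uniform ltr01 mg); last by move=> t; rewrite lee_fin powR_ge0.
rewrite subr0 invr1 mul1e -poweR_EFin; congr (_ `^ _)%E.
rewrite /mean /Rintegral fineK//.
have := tame_integrable (tame_powR_trig_sum G a (ltW p0)).
exact: integrable_fin_num.
Qed.

Lemma ler_root_powR (p C x y : R) : 0 < p -> 0 <= C -> 0 <= x -> 0 <= y ->
  (x `^ p^-1 <= C * y `^ p^-1) = (x <= C `^ p * y).
Proof.
move=> p0 C0 x0 y0.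
have K (u : R) : 0 <= u -> (u `^ p) `^ p^-1 = u.
  by move=> u0; rewrite -powRrM mulfV ?gt_eqF// powRr1.
rewrite -{1}(K C)// -powRM ?powR_ge0//.
have Cy : 0 <= C `^ p * y by rewrite mulr_ge0 ?powR_ge0.
have pV : 0 < p^-1 by rewrite invr_gt0.
apply/idP/idP => [|xy]; last by apply: (ge0_ler_powR (ltW pV)).
by apply: contraTT; rewrite -!ltNge => xy; apply: (gt0_ltr_powR pV).
Qed.

(** Removing the root of order [p] reduces comparisons of norms to comparisons of real means. *)
Lemma Lp_norm_le p C G (a b : int -> R[i]) : 0 < p -> 0 <= C ->
  (Lp_norm p (trig_sum G a) <= C%:E * Lp_norm p (trig_sum G b))%E <->
  mean (fun t => normc (trig_sum G a (expi t)) `^ p) <=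
  C `^ p * mean (fun t => normc (trig_sum G b (expi t)) `^ p).
Proof.
move=> p0 C0; rewrite !Lp_norm_trig_sum// -EFinM lee_fin ler_root_powR//;
  by apply: mean_ge0 => t; exact: powR_ge0.
Qed.

End measurability.

(** * At most two frequencies *)

Section translation.
Variable R : realType.
Implicit Types h : R -> R.

Let J (a b : R) h : R := (\int[@lebesgue_measure R]_(t in `[a, b]) h t)%R.

Lemma is_derive_shift (c t : R) : is_derive t 1 (fun x : R => x + c) 1.
Proof.
have := is_deriveD (is_derive_id t (1 : R)) (is_derive_cst c t (1 : R)).
by move=> H; refine (is_derive_eq H _); rewrite addr0.
Qed.

Let J_shift h (a b c : R) : a <= b -> continuous h ->
  J (a + c) (b + c) h = J a b (fun t => h (t + c)).
Proof.
move=> ab ch; pose F (x : R) : R := x + c.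
have dF (t : R) : is_derive t 1 F 1 by exact: is_derive_shift.
have cF : continuous F.
  move=> t; apply: differentiable_continuous; apply/derivable1_diffP.
  by have [] := dF t.
have F' : F^`()%classic = cst 1.
  by apply/funext => t; rewrite derive1E; have [_ ->] := dF t.
rewrite /J /Rintegral; congr fine.
rewrite (@integration_by_substitution_increasing _ F h a b)// ?F'.
- by apply: eq_integral => t _; rewrite /= mulr1.
- by move=> x y _ _ xy; rewrite /F ltrD2r.
- by move=> t _; exact: cvg_cst.
- exact: is_cvg_cst.
- exact: is_cvg_cst.
- split; first by move=> t _; have [] := dF t.
    by apply: cvg_at_right_filter; exact: cF.
  by apply: cvg_at_left_filter; exact: cF.
- exact: continuous_subspaceT.
Qed.

Let J_split h (a b c : R) : a <= c -> c <= b -> continuous h ->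
  J a b h = J a c h + J c b h.
Proof.
move=> ac cb ch.
have ih (x y : R) : (@lebesgue_measure R).-integrable `[x, y] (EFin \o h).
  apply: continuous_compact_integrable; first exact: segment_compact.
  exact: continuous_subspaceT.
apply/eqP; rewrite addrC -subr_eq; apply/eqP.
rewrite /J Rintegral_itvB ?bnd_simp//.
apply: Rintegral_itv_obnd_cbnd; apply: integrableS (ih c b) => //.
by apply: subset_itv; rewrite bnd_simp.
Qed.

(** Periodicity reduces [c] to its fractional part [d]. The interval [[d, 1 + d]] is then cut at 1,
    and the piece beyond 1 is moved back to [[0, d]]. *)
Lemma mean_shift h (c : R) : continuous h -> (forall t, h (t + 1) = h t) ->
  mean (fun t => h (t + c)) = mean h.
Proof.
move=> ch h1.
have hn (n : nat) t : h (t + n%:R) = h t.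
  by elim: n => [|n IH]; rewrite ?addr0// -natr1 addrA h1.
have hz (m : int) t : h (t + m%:~R) = h t.
  by case: m => n; rewrite ?hn// NegzE mulrNz -(hn n.+1 (t + _)) subrK.
pose d := c - (Num.floor c)%:~R.
have /andP[d0 d1] : 0 <= d <= 1.
  have /andP[f1 f2] := floor_itv c; rewrite /d subr_ge0 f1 /=.
  by rewrite lerBlDl; apply: ltW; move: f2; rewrite rmorphD.
transitivity (mean (fun t => h (t + d))).
  by apply: eq_mean => t; rewrite /d addrA -[in RHS](hz (Num.floor c)) subrK.
rewrite -[LHS]/(J 0 1 _) -[RHS]/(J 0 1 _) -J_shift// add0r.
rewrite (J_split d1) ?lerDl// (J_split d0 d1)// addrC; congr (_ + _).
have := @J_shift h 0 d 1 d0 ch; rewrite add0r addrC => ->.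
by apply: eq_Rintegral => t _; rewrite h1.
Qed.

Lemma continuous_normc_trig_sum G (a : int -> R[i]) :
  continuous (fun t : R => normc (trig_sum G a (expi t)) : R).
Proof.
have -> : (fun t : R => normc (trig_sum G a (expi t)) : R) =
    (fun t => Num.sqrt (normc (trig_sum G a (expi t)) ^+ (2 * 1))).
  by apply/funext => t; rewrite muln1 sqrtr_sqr ger0_norm ?normc_ge0.
suff ch : continuous (fun t : R => normc (trig_sum G a (expi t)) ^+ (2 * 1) : R).
  by move=> t; exact: (continuous_comp (ch t) (@sqrt_continuous R _)).
rewrite (funext (normc_trig_sumX 1 G a)).
elim: (index_enum _) => [|u s IH].
  by under eq_fun do rewrite big_nil; move=> t; exact: cvg_cst.
under eq_fun do rewrite big_cons.
by move=> t; apply: cvgD; [exact: continuous_Re_cexpi|exact: IH].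
Qed.

(** Where [g] is positive the power is differentiable; near a zero of [g], values at most 1 are only
    decreased by an exponent [p >= 1]. *)
Lemma continuous_powR_comp (g : R -> R) (p : R) : 1 <= p ->
  (forall t, 0 <= g t) -> continuous g -> continuous (fun t => g t `^ p).
Proof.
move=> p1 g0 cg t; have p0 : 0 < p by apply: lt_le_trans p1.
have := g0 t; rewrite le_eqVlt => /predU1P[gt0|gt0]; last first.
  have cp : {for g t, continuous (@powR R ^~ p)}.
    apply: differentiable_continuous; apply/derivable1_diffP.
    by have [] := is_derive1_powR p gt0.
  exact: (continuous_comp (cg t) cp).
have gp0 : g t `^ p = 0 by rewrite -gt0 powR0 ?gt_eqF.
rewrite /continuous_at gp0.
apply/cvgr0Pnorm_lt => e e0.
have m0 : 0 < Num.min e 1 by rewrite lt_min e0 ltr01.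
have /cvgr0Pnorm_lt/(_ _ m0) : g x @[x --> t] --> 0 by rewrite gt0; exact: cg.
apply: filterS => x; rewrite lt_min !ger0_norm ?powR_ge0// => /andP[xe x1].
have := g0 x; rewrite le_eqVlt => /predU1P[<-|gx0]; first by rewrite powR0 ?gt_eqF.
by apply: le_lt_trans xe; apply: ge1r_powR => //; rewrite gx0 (ltW x1).
Qed.

Lemma trig_sum_period G (a : int -> R[i]) (t : R) :
  trig_sum G a (expi (t + 1)) = trig_sum G a (expi t).
Proof.
rewrite !trig_sum_expi; apply: eq_bigr => q _.
by rewrite mulrDr mulr1 cexpiD cexpi_int mulr1.
Qed.

End translation.

Section two_elements.
Variable R : realType.

(** Two unimodular factors amount to a rotation and one global factor: [c] is chosen so that the
    rotation produces the quotient of the factors. *)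
Lemma two_element_rotation (G : {fset int}) (a eps : int -> R[i]) (p q : int) :
  p != q -> [set` G] `<=` [set p; q] ->
  (forall x, x \in G -> normc (eps x) = 1) ->
  exists c : R, forall t : R,
    normc (trig_sum G (fun x => eps x * a x) (expi t)) =
    normc (trig_sum G a (expi (t + c))).
Proof.
(* Extension by 1 makes the factors at [p] and [q] unimodular even when one of them is outside
   [G]. *)
move=> pq Gpq eps1; pose e x := if x \in G then eps x else 1.
have e1 x : normc (e x) = 1 by rewrite /e; case: ifP => [/eps1|_]//; exact: normc1.
have [y ye] : exists y : R, e q / e p = cexpi y.
  by apply: cexpi_surj; rewrite normcM normcV !e1 invr1 mulr1.
have qp0 : (q - p)%:~R != 0 :> R by rewrite intr_eq0 subr_eq0 eq_sym.
pose c := y / (q - p)%:~R; exists c => t.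
have e0 x : e x != 0 by exact: unimodular_neq0.
have ex x : x \in G -> eps x = e p * cexpi (- (p%:~R * c)) * cexpi (x%:~R * c).
  move=> xG; have -> : eps x = e x by rewrite /e xG.
  rewrite -mulrA -cexpiD.
  have [->|->] := Gpq _ xG; first by rewrite addNr cexpi0 mulr1.
  have -> : - (p%:~R * c) + q%:~R * c = y.
    by rewrite addrC -mulrBl -rmorphB /= mulrC divfK.
  by rewrite -ye mulrC divfK.
transitivity (normc (e p * cexpi (- (p%:~R * c)) * trig_sum G a (expi (t + c)))).
  congr normc; rewrite !trig_sum_expi mulr_sumr; apply: eq_bigr => x _.
  rewrite ex; last exact: valP.
  by rewrite mulrDr cexpiD; ring.
by rewrite !normcM e1 normc_cexpi !mul1r.
Qed.

Lemma two_elements_Lp (E : set int) (p q : int) (r : R) : 1 <= r ->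
  p != q -> E `<=` [set p; q] -> one_unconditional (Lp_norm r) E.
Proof.
move=> r1 pq Epq G a eps GE eps1.
have r0 : 0 < r by apply: lt_le_trans r1.
have [c cE] := two_element_rotation a pq (subset_trans GE Epq) eps1.
pose h t := normc (trig_sum G a (expi t)) `^ r.
have ch : continuous h.
  apply: continuous_powR_comp r1 _ _; first by move=> t; exact: normc_ge0.
  exact: continuous_normc_trig_sum.
have h1 t : h (t + 1) = h t by rewrite /h trig_sum_period.
apply/(Lp_norm_le _ _ _ r0 ler01); rewrite powR1 mul1r.
suff -> : mean (fun t => normc (trig_sum G (fun q => eps q * a q) (expi t)) `^ r) =
    mean h by exact: lexx.
rewrite -(mean_shift c ch h1).
by apply: eq_mean => {ch h1} t; rewrite cE.
Qed.

Lemma two_elements_sup (E : set int) (p q : int) :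
  p != q -> E `<=` [set p; q] -> one_unconditional (@sup_norm R) E.
Proof.
move=> pq Epq G a eps GE eps1; rewrite mul1e.
have [c cE] := two_element_rotation a pq (subset_trans GE Epq) eps1.
apply: ge_ereal_sup => _ [z _ <-]; have [t ->] := expi_surj z.
by rewrite cE; apply: ereal_sup_ubound; exists (expi (t + c)).
Qed.

Lemma card_le2_or_three (E : set int) :
  (exists p q, p != q /\ E `<=` [set p; q]) \/
  (exists p0 p1 p2, [/\ p0 < p1, p1 < p2, E p0, E p1 & E p2]).
Proof.
have [[p Ep]|E0] := pselect (exists p, E p); last first.
  by left; exists 0, 1; split=> // x Ex; exfalso; apply: E0; exists x.
have [[q [Eq pq]]|E1] := pselect (exists q, E q /\ p != q); last first.
  (* A singleton is padded to a pair of distinct integers. *)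
  left; exists p, (p + 1); split; first by lia.
  move=> x Ex; left; apply: contrapT => xp; apply: E1; exists x; split => //.
  by apply/eqP => px; apply: xp.
have [[r [Er pr qr]]|E2] := pselect (exists r, [/\ E r, p != r & q != r]); last first.
  left; exists p, q; split => // x Ex; apply: contrapT => xpq; apply: E2.
  exists x; split => //; apply/eqP => px; apply: xpq; [left|right]; exact/esym.
right.
have [pq'|pq'] : p < q \/ q < p by lia.
  have [pr'|pr'] : p < r \/ r < p by lia.
    have [qr'|qr'] : q < r \/ r < q by lia.
      by exists p, q, r.
    by exists p, r, q.
  by exists r, p, q.
have [pr'|pr'] : p < r \/ r < p by lia.
  by exists q, p, r.
have [qr'|qr'] : q < r \/ r < q by lia.
  by exists q, r, p.
by exists r, q, p.
Qed.

Lemma card_le2P (E : set int) :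
  (E #<= `I_2)%card <-> exists p q, p != q /\ E `<=` [set p; q].
Proof.
split=> [E2|[p [q [_ Epq]]]].
  have [//|[p0 [p1 [p2 [p01 p12 E0 E1 E2']]]]] := card_le2_or_three E.
  have /pcard_leP[f] := E2.
  have fI x : E x -> (f x < 2)%N by move=> Ex; exact: (@funS _ _ _ _ f x Ex).
  have fi x y : E x -> E y -> f x = f y -> x = y.
    by move=> Ex Ey; apply: inj; rewrite inE.
  have : f p0 = f p1 \/ f p1 = f p2 \/ f p0 = f p2.
    move: (f p0) (f p1) (f p2) (fI _ E0) (fI _ E1) (fI _ E2').
    by move=> [|[|?]] [|[|?]] [|[|?]]//; tauto.
  case=> [/(fi _ _ E0 E1)|[/(fi _ _ E1 E2')|/(fi _ _ E0 E2')]] pE; exfalso; lia.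
apply: card_le_trans (subset_card_le Epq) _.
have -> : [set p; q] = [set (if n == 0%N then p else q) | n in `I_2].
  apply/seteqP; split => [x [->|->]|x [[|[|n]] // _ <-]].
  - by exists 0%N.
  - by exists 1%N.
  - by left.
  - by right.
exact: card_image_le.
Qed.

End two_elements.

(** * Taylor approximation of real powers at 1 *)

Section taylor.
Variable R : realType.

(** On this interval the logarithm has modulus at most 1, by [ln x <= x - 1] at [y] and at its
    inverse. This starts the Taylor induction. *)
Lemma powR_le_expR (s y : R) : `|y - 1| <= 1 / 2 -> `|y `^ s| <= expR `|s|.
Proof.
rewrite ler_distl => /andP[y1 y2].
have y0 : 0 < y by lra.
rewrite ger0_norm ?powR_ge0// /powR gt_eqF// ler_expR.
apply: le_trans (ler_norm _) _; rewrite normrM ler_piMr//.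
rewrite ler_norml; apply/andP; split.
  have : ln y^-1 <= y^-1 - 1.
    have := @expR_ge1Dx R (ln y^-1); rewrite lnK ?posrE ?invr_gt0//.
    by rewrite addrC lerBrDr.
  rewrite lnV ?posrE// => h; rewrite -lerN2 opprK; apply: le_trans h _.
  rewrite lerBlDr; apply: (@le_trans _ _ (1 / 2)^-1); last by rewrite div1r invrK; lra.
  by rewrite lef_pV2 ?posrE; lra.
have := @expR_ge1Dx R (ln y); rewrite lnK ?posrE//; lra.
Qed.

(** The mean value theorem between 1 and [y], on either side of 1, raises the order of vanishing by
    one. *)
Lemma mvt_power_bound (g dg : R -> R) (K : R) (n : nat) :
  (forall y : R, `|y - 1| <= 1 / 2 -> is_derive y 1 g (dg y)) ->
  (forall y : R, `|y - 1| <= 1 / 2 -> `|dg y| <= K * `|y - 1| ^+ n) ->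
  0 <= K -> g 1 = 0 ->
  forall y : R, `|y - 1| <= 1 / 2 -> `|g y| <= K * `|y - 1| ^+ n.+1.
Proof.
move=> hg hdg K0 g1 y y1.
have cg (a b : R) : (forall x, x \in `[a, b] -> `|x - 1| <= 1 / 2) ->
    {within `[a, b], continuous g}.
  move=> ab; apply: derivable_within_continuous => x xab.
  by have [] := hg x (ab x xab).
have main (c : R) : `|c - 1| <= `|y - 1| -> `|g y| = `|dg c| * `|y - 1| ->
    `|g y| <= K * `|y - 1| ^+ n.+1.
  move=> cy ->; rewrite exprSr mulrA ler_wpM2r//.
  apply: le_trans (hdg c (le_trans cy y1)) _.
  by rewrite ler_wpM2l// lerXn2r ?nnegrE.
have [le1y|/ltW ley1] := leP 1 y.
  have near1 x : x \in `[1, y] -> `|x - 1| <= `|y - 1|.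
    by rewrite in_itv /= => /andP[x1 xy]; rewrite !ger0_norm; lra.
  have hd x : x \in `]1, y[ -> is_derive x 1 g (dg x).
    by move=> /subset_itv_oo_cc/near1 h; apply: hg; exact: le_trans h y1.
  have [c cI gE] := MVT_segment le1y hd (cg _ _ (fun x xI => le_trans (near1 x xI) y1)).
  by apply: (main c); [exact: near1|rewrite -normrM -gE g1 subr0].
have near1 x : x \in `[y, 1] -> `|x - 1| <= `|y - 1|.
  by rewrite in_itv /= => /andP[x1 xy]; rewrite !ler0_norm; lra.
have hd x : x \in `]y, 1[ -> is_derive x 1 g (dg x).
  by move=> /subset_itv_oo_cc/near1 h; apply: hg; exact: le_trans h y1.
have [c cI gE] := MVT_segment ley1 hd (cg _ _ (fun x xI => le_trans (near1 x xI) y1)).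
apply: (main c); first exact: near1.
by rewrite distrC -normrM -gE g1 sub0r normrN.
Qed.

(** Induction through the derivative [s * y ^ (s - 1)]. Each step multiplies the top coefficient by
    a nonzero factor because [s] is not a natural number. The polynomial is in [y], not [y - 1],
    since powers of [y] will become even moments. *)
Lemma powR_taylor (n : nat) (s : R) : (forall k : nat, s <> k%:R) ->
  exists (T : {poly R}) (C : R),
    [/\ (size T <= n)%N, (0 < n)%N -> T`_n.-1 != 0, 0 <= C
      & forall y, `|y - 1| <= 1 / 2 -> `|y `^ s - T.[y]| <= C * `|y - 1| ^+ n].
Proof.
elim: n s => [|n IH] s sN.
  exists 0, (expR `|s|); split; rewrite ?size_poly0 ?expR_ge0// => y y1.
  by rewrite horner0 subr0 expr0 mulr1; exact: powR_le_expR.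
have s0 : s != 0 by apply/eqP; exact: (sN 0%N).
have [k /(congr1 (+%R 1))|T [C [sT Tn C0 bT]]] := IH (s - 1).
  by rewrite addrC subrK nat1r => sk; exact: (sN k.+1).
(* [P] is the primitive of [s *: T] without constant term; the constant added in [Q] gives the value
   1 at 1. *)
pose P := \poly_(i < n.+1) (if i is i'.+1 then s * T`_i' / i%:R else 0).
pose Q := P + (1 - P.[1])%:P.
have Q1 : Q.[1] = 1 by rewrite /Q hornerD hornerC addrC subrK.
have dQ : Q^`() = s *: T.
  apply/polyP => i; rewrite coef_deriv coefZ coefD coefC addr0 coef_poly ltnS.
  case: ltnP => [_|ni]; first by rewrite -[LHS]mulr_natr divfK// pnatr_eq0.
  by rewrite mul0rn nth_default ?mulr0// (leq_trans sT).
exists Q, (`|s| * C); split.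
- apply: leq_trans (size_polyD _ _) _; rewrite geq_max size_poly.
  by rewrite (leq_trans (size_polyC_leq1 _)).
(* When [n] is 0, [Q] is the constant 1; otherwise its top coefficient is that of [T] times [s],
   divided by the degree. *)
- move=> _ /=; case: n @P @Q Q1 dQ sT Tn {IH bT} => [|n] P Q Q1 dQ sT Tn.
    have P0 : P = 0.
      by apply/polyP => i; rewrite coef_poly coef0; case: i => [|i]; rewrite ?if_same.
    by rewrite /Q P0 horner0 subr0 add0r coefC eqxx oner_neq0.
  rewrite /Q coefD coefC addr0 coef_poly ltnSn.
  by rewrite !mulf_neq0 ?Tn// invr_eq0 pnatr_eq0.
- by rewrite mulr_ge0.
move=> y y1.
pose g (y : R) := y `^ s - Q.[y].
apply: (@mvt_power_bound g (fun y => s * y `^ (s - 1) - (Q^`()).[y])) => //.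
- move=> x; rewrite ler_distl => /andP[x1 x2].
  have x0 : 0 < x by lra.
  exact: (is_deriveB (is_derive1_powR s x0) (is_derive_poly Q x)).
- move=> x x1; rewrite dQ hornerZ -mulrBr normrM -mulrA ler_wpM2l//.
  exact: bT.
- by rewrite mulr_ge0.
- by rewrite /g Q1 powR1 subrr.
Qed.

End taylor.

(** * Three frequencies *)

Section three_elements.
Variable R : realType.
Implicit Types (p : R) (a eps c : int -> R[i]).

Lemma uniq_increasing (p0 p1 p2 : int) :
  p0 < p1 -> p1 < p2 -> uniq [:: p0; p1; p2].
Proof.
move=> p01 p12; rewrite /= !inE.
by apply/and3P; split=> //; [apply/norP; split|]; apply/eqP; lia.
Qed.

Lemma normc_geom_le (z : R[i]) n : normc z = 1 ->
  normc (z ^+ n - 1) <= n%:R * normc (z - 1).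
Proof.
move=> z1; rewrite subrX1 normcM mulrC ler_wpM2r ?normc_ge0//.
apply: le_trans (normc_sum _ _) _.
rewrite (eq_bigr (fun=> 1)) ?sumr_const ?card_ord// => i _.
by rewrite normcX z1 expr1n.
Qed.

Lemma normc_opp1 : normc (-1 : R[i]) = 1.
Proof. by rewrite /normc /= oppr0 expr0n sqrrN expr1n addr0 sqrtr1. Qed.

(** The parallelogram identity for 1 and [z]: the squared moduli of their sum and difference add up
    to 4. *)
Lemma normc_add1_le (z : R[i]) (d : R) : normc z = 1 -> 0 <= d ->
  d <= normc (z - 1) -> normc (1 + z) <= Num.sqrt (4 - d ^+ 2).
Proof.
move=> z1 d0 dz; rewrite -[leLHS]ger0_norm ?normc_ge0// -sqrtr_sqr ler_wsqrtr//.
have dz2 : d ^+ 2 <= normc (z - 1) ^+ 2 by rewrite lerXn2r ?nnegrE ?normc_ge0.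
suff : normc (1 + z) ^+ 2 + normc (z - 1) ^+ 2 = 4 by lra.
have : normc z ^+ 2 = 1 by rewrite z1 expr1n.
case: z {z1 dz dz2} => x y; rewrite !sqr_normc_Re /=; lra.
Qed.

Lemma trig_sum_seq_fset (s : seq int) a (u : circle R) : uniq s ->
  trig_sum (seq_fset tt s) a u = \sum_(q <- s) a q * trig q u.
Proof. by move=> us; rewrite /trig_sum (perm_big _ (seq_fset_perm tt s)) undup_id. Qed.

(** The coefficients 1, [eta], 1 with [eta ^+ n = -1] prevent the three terms from aligning, so the
    norm stays below 3; multiplying by the inverse factors gives the value 3 at the point 1. *)
Lemma sup_norm_three (E : set int) (p0 p1 p2 : int) : p0 < p1 -> p1 < p2 ->
  E p0 -> E p1 -> E p2 -> ~ one_unconditional (@sup_norm R) E.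
Proof.
move=> p01 p12 E0 E1 E2 uE.
have [m [m0 mE]] : exists m : nat, (0 < m)%N /\ p1 = p0 + m%:Z.
  by exists `|p1 - p0|%N; split; lia.
have [n [n0 nE]] : exists n : nat, (0 < n)%N /\ p2 = p0 + n%:Z.
  by exists `|p2 - p0|%N; split; lia.
have [eta eta1 etan] := root_of_opp1 R n0.
have eta0 : eta != 0 by exact: unimodular_neq0.
have us := uniq_increasing p01 p12.
pose c (q : int) : R[i] := if q == p1 then eta else 1.
pose G : {fset int} := seq_fset tt [:: p0; p1; p2].
have GE : [set` G] `<=` E.
  by move=> q /=; rewrite /G seq_fsetE !inE => /or3P[] /eqP ->.
have c1 q : normc (c q) = 1 by rewrite /c; case: ifP => // _; exact: normc1.
have cV1 q : q \in G -> normc (c q)^-1 = 1.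
  by move=> _; rewrite normcV c1 invr1.
have := uE _ c _ GE cV1; rewrite mul1e; apply/negP; rewrite -ltNge.
(* If [v] and [w] below were both closer to 1 than this [d], the weighted sum in [key] would be less
   than 2. *)
pose d : R := 2 / (n + m)%:R.
have nm0 : 0 < (n + m)%:R :> R by rewrite ltr0n addn_gt0 n0.
have d0 : 0 < d by rewrite divr_gt0.
apply: (@le_lt_trans _ _ (1 + Num.sqrt (4 - d ^+ 2))%:E); last first.
  apply: (@lt_le_trans _ _ 3%:E); last first.
    apply: ereal_sup_ubound; exists (expi 0) => //.
    rewrite /G trig_sum_seq_fset// !big_cons big_nil /trig -/(cexpi 0) cexpi0 !exp1rz.
    rewrite !mulVf ?oner_neq0 /c ?eqxx//; do ?[case: ifP => // _; rewrite ?oner_neq0//].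
    rewrite !mulr1 addr0 /normc /= !addr0 expr0n addr0 sqrtr_sqr ger0_norm; last by lra.
    by congr (_%:E); lra.
  rewrite lte_fin; suff : Num.sqrt (4 - d ^+ 2) < 2 by lra.
  have d2 : 0 < d ^+ 2 by rewrite exprn_gt0.
  rewrite -[ltRHS](@ger0_norm R 2) // -sqrtr_sqr ltr_sqrt; lra.
apply: ge_ereal_sup => _ [u _ <-]; rewrite lee_fin.
pose z := cval u.
have z1 : normc z = 1 by exact: normc_cval.
have z0 : z != 0 by exact: unimodular_neq0.
pose v := eta * z ^+ m; pose w := z ^+ n.
have v1 : normc v = 1 by rewrite normcM normcX z1 eta1 expr1n mulr1.
have w1 : normc w = 1 by rewrite normcX z1 expr1n.
have -> : trig_sum G c u = z ^ p0 * (1 + v + w).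
  rewrite /G trig_sum_seq_fset// !big_cons big_nil addr0 /trig -/z.
  have cp0 : c p0 = 1 by rewrite /c ifF//; apply/eqP; lia.
  have cp1 : c p1 = eta by rewrite /c eqxx.
  have cp2 : c p2 = 1 by rewrite /c ifF//; apply/eqP; lia.
  have zp1 : z ^ p1 = z ^ p0 * z ^+ m by rewrite mE exprzDr ?unitfE.
  have zp2 : z ^ p2 = z ^ p0 * z ^+ n by rewrite nE exprzDr ?unitfE.
  rewrite cp0 cp1 cp2 zp1 zp2 /v /w; move: (z ^ p0) (z ^+ m) (z ^+ n) => x y t.
  by rewrite !mul1r mulrCA [RHS]mulrDr mulrDr mulr1 -addrA.
rewrite normcM normc_exprz z1 exp1rz mul1r.
(* Since [eta ^+ n = -1], the powers [v ^+ n] and [w ^+ m] are opposite, so they cannot both be near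
   1. *)
have key : 2 <= n%:R * normc (v - 1) + m%:R * normc (w - 1).
  apply: le_trans (lerD (normc_geom_le n v1) (normc_geom_le m w1)).
  apply: le_trans (le_normcD _ _).
  have -> : v ^+ n - 1 + (w ^+ m - 1) = -1 + -1.
    by rewrite /v /w exprMn etan -!exprM mulnC; ring.
  by rewrite -mulr2n normcMn normc_opp1.
have [dv|vd] := leP d (normc (v - 1)).
  apply: le_trans (le_normcD _ _) _; rewrite w1 [leLHS]addrC lerD2l.
  by apply: normc_add1_le => //; exact: ltW.
have [dw|wd] := leP d (normc (w - 1)).
  rewrite addrAC; apply: le_trans (le_normcD _ _) _; rewrite v1 [leLHS]addrC lerD2l.
  by apply: normc_add1_le => //; exact: ltW.
exfalso; move: key; apply/negP; rewrite -ltNge.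
have -> : 2 = n%:R * d + m%:R * d :> R.
  by rewrite -mulrDl -natrD /d mulrC divfK// gt_eqF.
by rewrite ltrD// ltr_pM2l// ltr0n.
Qed.

Lemma mulrn_int (x : int) (n : nat) : x *+ n = x * n%:Z.
Proof. by rewrite -mulr_natr natz. Qed.

(* i and j are the coefficients of the shortest relation expressing a multiple
   of the middle element by the outer ones. *)
Lemma minimal_relation (p0 p1 p2 : int) : p0 < p1 -> p1 < p2 ->
  exists i j : nat, [/\ (0 < j)%N, p0 *+ i + p2 *+ j = p1 *+ (i + j)
    & forall b, (b < i + j)%N -> unique_sums b [set x | x \in [:: p0; p1; p2]]].
Proof.
move=> p01 p12.
pose P k := (0 < k)%N &&
  [exists i : 'I_k.+1, p0 *+ i + p2 *+ (k - i) == p1 *+ k].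
have PI (i j : nat) : (0 < i + j)%N -> p0 *+ i + p2 *+ j = p1 *+ (i + j) -> P (i + j)%N.
  move=> ij0 e; rewrite /P ij0; apply/existsP.
  exists (inord i); rewrite inordK ?ltnS ?leq_addr//.
  by rewrite addnC addnK addnC e.
have exP : exists k, P k.
  (* The middle element is a convex combination of the outer ones, with weights proportional to
     these two gaps. *)
  exists (`|p2 - p1| + `|p1 - p0|)%N; apply: PI; first lia.
  rewrite !mulrn_int; nia.
case: (ex_minnP exP) => k /andP[k0 /existsP[i /eqP kE]] kmin.
exists (i : nat), (k - i)%N.
have ik : (i <= k)%N by rewrite -ltnS.
rewrite subnKC//; split => //.
  rewrite lt0n; apply/eqP => ki; move: kE.
  rewrite ki mulr0n addr0 (_ : (i : nat) = k); last by lia.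
  by rewrite !mulrn_int; nia.
move=> b bk s1 s2 sz1 sz2 sE1 sE2 s12.
have us := uniq_increasing p01 p12.
have cnt (V : nmodType) (f : int -> V) s : {in s, forall q, q \in [:: p0; p1; p2]} ->
    f p0 *+ count_mem p0 s + (f p1 *+ count_mem p1 s + f p2 *+ count_mem p2 s) =
    \sum_(x <- s) f x.
  by move=> /(sum_count_mem f us) <-; rewrite !big_cons big_nil addr0.
have cntsz s : {in s, forall q, q \in [:: p0; p1; p2]} ->
    (count_mem p0 s + (count_mem p1 s + count_mem p2 s) = size s)%N.
  have one (l : nat) : 1%N *+ l = l by exact: natn.
  by move=> /(cnt _ (fun=> 1%N)); rewrite !one -sum1_size => <-.
have [h1 h2] := (cntsz _ sE1, cntsz _ sE2); rewrite sz1 in h1; rewrite sz2 in h2.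
have := cnt _ id _ sE1; have := cnt _ id _ sE2.
rewrite s12 => {cnt cntsz} <-.
rewrite !mulrn_int => h.
have [e0 [e1 e2]] : count_mem p0 s1 = count_mem p0 s2 /\
    count_mem p1 s1 = count_mem p1 s2 /\ count_mem p2 s1 = count_mem p2 s2.
  move: (count_mem p0 s1) (count_mem p1 s1) (count_mem p2 s1) h1 h.
  move: (count_mem p0 s2) (count_mem p1 s2) (count_mem p2 s2) h2.
  move=> B0 B1 B2 h2 A0 A1 A2 h1 h.
  have rel (i' j : nat) : (i' + j < k)%N ->
      p0 * i'%:Z + p2 * j%:Z = p1 * (i' + j)%N%:Z -> i' = 0%N /\ j = 0%N.
    move=> ijk e; have [|ij0] := posnP (i' + j)%N; first by lia.
    have /kmin : P (i' + j)%N by apply: PI => //; rewrite !mulrn_int.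
    by lia.
  (* Eliminating the middle counts shows that the outer counts differ in the same direction.
     Cancelling common letters then leaves a relation of length at most [b], which [rel] makes
     trivial. *)
  have hz : (p1 - p0) * (B0%:Z - A0%:Z) = (p2 - p1) * (B2%:Z - A2%:Z).
    have eB : B1%:Z = b%:Z - B0%:Z - B2%:Z by lia.
    have eA : A1%:Z = b%:Z - A0%:Z - A2%:Z by lia.
    by move: h; rewrite eA eB; nia.
  have [A0B0|/ltnW B0A0] := leqP A0 B0.
    have A2B2 : (A2 <= B2)%N by nia.
    have := rel (B0 - A0)%N (B2 - A2)%N.
    by case; nia.
  have B2A2 : (B2 <= A2)%N by nia.
  by case: (rel (A0 - B0)%N (A2 - B2)%N); nia.
apply/allP => x; rewrite mem_cat => xs /=.
have : x \in [:: p0; p1; p2] by case/orP: xs => [/sE1|/sE2].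
by rewrite !inE => /or3P[] /eqP ->; apply/eqP.
Qed.

End three_elements.

(** * Three frequencies when the exponent is not an even integer *)

Section three_elements_Lp.
Variable R : realType.
Implicit Types (a eps c : int -> R[i]).

(** The reverse inequality comes from applying the inverse factors to the modified coefficients. *)
Lemma unconditional_Lp_eq (p : R) (E : set int) (G : {fset int}) a eps :
  0 < p -> one_unconditional (Lp_norm p) E -> [set` G] `<=` E ->
  (forall q, normc (eps q) = 1) ->
  mean (fun t => normc (trig_sum G (fun q => eps q * a q) (expi t)) `^ p) =
  mean (fun t => normc (trig_sum G a (expi t)) `^ p).
Proof.
move=> p0 uE GE eps1.
have le1 b e : (forall q, normc (e q) = 1) ->
    mean (fun t => normc (trig_sum G (fun q => e q * b q) (expi t)) `^ p) <=
    mean (fun t => normc (trig_sum G b (expi t)) `^ p).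
  move=> e1; have := uE G b e GE (fun q _ => e1 q).
  by move=> /(Lp_norm_le G _ _ p0 ler01); rewrite powR1 mul1r.
have epsV1 q : normc (eps q)^-1 = 1 by rewrite normcV eps1 invr1.
have epsK : (fun q => (eps q)^-1 * (eps q * a q)) = a.
  by apply/funext => q; rewrite mulKf//; exact: unimodular_neq0.
have ge1 := le1 (fun q => eps q * a q) _ epsV1; rewrite epsK in ge1.
apply: le_anti; apply/andP; split; [exact: (le1 a eps eps1)|exact: ge1].
Qed.

(** The integrand is the power [p / 2] of the squared modulus; the mean of [T] at the squared
    modulus is a combination of even moments, and the pointwise error survives integration over an
    interval of length 1. *)
Lemma mean_taylor_le (p : R) (n : nat) (T : {poly R}) (C d : R) G c :
  0 < p -> (size T <= n)%N -> 0 <= C -> 0 <= d -> d <= 1 / 2 ->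
  (forall y, `|y - 1| <= 1 / 2 -> `|y `^ (p / 2) - T.[y]| <= C * `|y - 1| ^+ n) ->
  (forall t, `|normc (trig_sum G c (expi t)) ^+ 2 - 1| <= d) ->
  `|mean (fun t => normc (trig_sum G c (expi t)) `^ p) -
    \sum_(i < n) T`_i * wenergy i G c| <= C * d ^+ n.
Proof.
move=> p0 sT C0 d0 d12 TC yd.
pose y t := normc (trig_sum G c (expi t)) ^+ 2.
have ty (i : nat) : tame (fun t => y t ^+ i).
  by apply: tameX; exact: (tame_normc_trig_sumX 1).
have tT : tame (fun t => T.[y t]).
  under eq_fun do rewrite (horner_coef_wide _ sT).
  by apply: tame_sum => i; apply: tameM (ty i); exact: tame_cst.
have tp := tame_powR_trig_sum G c (ltW p0).
have <- : mean (fun t => T.[y t]) = \sum_(i < n) T`_i * wenergy i G c.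
  under eq_mean do rewrite (horner_coef_wide _ sT).
  rewrite mean_sum; last by move=> i; apply: tameM (ty i); exact: tame_cst.
  apply: eq_bigr => i _; rewrite meanZ; last exact: ty.
  rewrite -mean_normc_trig_sumX; congr (_ * _); apply: eq_mean => t.
  by rewrite /y exprM.
rewrite -meanB//.
have bound t : `|normc (trig_sum G c (expi t)) `^ p - T.[y t]| <= C * d ^+ n.
  have yp : normc (trig_sum G c (expi t)) `^ p = y t `^ (p / 2).
    rewrite /y -powR_mulrn ?normc_ge0// -powRrM; congr (_ `^ _).
    by rewrite mulrC divfK// pnatr_eq0.
  rewrite yp; apply: le_trans (TC _ (le_trans (yd t) d12)) _.
  by rewrite ler_wpM2l// lerXn2r ?nnegrE// yd.
have tB : tame (fun t => normc (trig_sum G c (expi t)) `^ p - T.[y t]).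
  have -> : (fun t => normc (trig_sum G c (expi t)) `^ p - T.[y t]) =
      (fun t => normc (trig_sum G c (expi t)) `^ p + (-1) * T.[y t]).
    by apply/funext => t; rewrite mulN1r.
  by apply: tameD => //; apply: tameM tT; exact: tame_cst.
rewrite ler_norml; apply/andP; split.
  rewrite -[leLHS]mean_cst; apply: ler_mean => //; first exact: tame_cst.
  by move=> t; have := bound t; rewrite ler_norml => /andP[].
rewrite -[leRHS]mean_cst; apply: ler_mean => //; first exact: tame_cst.
by move=> t; have := bound t; rewrite ler_norml => /andP[].
Qed.

(** The modulus is within [2 * r] of 1, and [4 * r + 4 * r ^+ 2 <= 6 * r] because [r <= 1 / 2]. *)
Lemma near_one_sqr (G : {fset int}) c (p0 p1 p2 : int) (r : R) (t : R) :
  uniq [:: p0; p1; p2] -> G = seq_fset tt [:: p0; p1; p2] ->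
  0 <= r -> r <= 1 / 2 ->
  normc (c p0) = r -> normc (c p1) = 1 -> normc (c p2) = r ->
  `|normc (trig_sum G c (expi t)) ^+ 2 - 1| <= 6 * r.
Proof.
move=> us -> r0 r1 c0 c1 c2; rewrite trig_sum_seq_fset// !big_cons big_nil addr0.
have tn q : normc (c q * trig q (expi t)) = normc (c q).
  by rewrite normcM /trig normc_exprz normc_cval exp1rz mulr1.
set A := c p0 * _; set B := c p1 * _; set D := c p2 * _.
have A1 : normc A = r by rewrite tn.
have B1 : normc B = 1 by rewrite tn.
have D1 : normc D = r by rewrite tn.
have up : normc (A + (B + D)) <= 1 + 2 * r.
  have := le_normcD A (B + D); have := le_normcD B D; rewrite A1 B1 D1; lra.
have lo : 1 - 2 * r <= normc (A + (B + D)).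
  have : normc B <= normc (A + (B + D)) + (normc (- A) + normc (- D)).
    have {1}-> : B = (A + (B + D)) + (- A - D) by ring.
    by apply: le_trans (le_normcD _ _) _; rewrite lerD2l; exact: le_normcD.
  by rewrite !normcN A1 B1 D1; lra.
move: up lo; set x := normc _ => up lo.
have x0 : 0 <= x by exact: normc_ge0.
by rewrite ler_norml; apply/andP; split; nra.
Qed.

Lemma Lp_norm_three (p : R) (E : set int) (p0 p1 p2 : int) :
  1 <= p -> (forall k : int, p <> (2 * k)%:~R) -> p0 < p1 -> p1 < p2 ->
  E p0 -> E p1 -> E p2 -> ~ one_unconditional (Lp_norm p) E.
Proof.
move=> pge1 pN p01 p12 E0 E1 E2 uE.
have pgt0 : 0 < p by apply: lt_le_trans pge1.
have sN (k : nat) : p / 2 <> k%:R.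
  move=> pk; apply: (pN k%:Z).
  have -> : (2 * k%:Z)%:~R = 2 * k%:R :> R by rewrite rmorphM.
  by rewrite -pk mulrC divfK// pnatr_eq0.
have [i [j [j0 ijE ijmin]]] := minimal_relation p01 p12.
have [om om1 omj] := root_of_opp1 R j0.
(* One order beyond the relation length: the coefficient of index [i + j] is the top one, and the
   error is of higher order in [r]. *)
have [T [C [sT Tn C0 TC]]] := powR_taylor (i + j).+1 sN.
have {}Tn : T`_(i + j) != 0 by exact: Tn.
have us := uniq_increasing p01 p12.
pose G : {fset int} := seq_fset tt [:: p0; p1; p2].
have GP q : q \in G -> q \in [:: p0; p1; p2] by rewrite /G seq_fsetE.
have GE : [set` G] `<=` E by move=> q /GP; rewrite !inE => /or3P[] /eqP ->.
pose e q : R[i] := if q == p2 then om else 1.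
have e1 q : normc (e q) = 1 by rewrite /e; case: ifP => // _; exact: normc1.
have p10 : (p0 == p1) = false by apply/eqP; lia.
have p20 : (p0 == p2) = false by apply/eqP; lia.
have p21 : (p1 == p2) = false by apply/eqP; lia.
(* The bound [1 / 12] puts the squared modulus within [1 / 2] of 1, where the Taylor estimate
   holds. *)
have main (r : R) : 0 < r -> r <= 1 / 12 -> `|T`_(i + j)| <= C * 6 ^+ (i + j).+1 * r.
  move=> r0 r12; pose a q : R[i] := if q == p1 then 1 else r%:C%C.
  have a0 q : 0 <= a q by rewrite /a; case: ifP => // _; rewrite ler0c ltW.
  have nr : normc (r%:C%C) = r by rewrite /normc /= expr0n addr0 sqrtr_sqr gtr0_norm.
  have ap0 : a p0 = r%:C%C by rewrite /a p10.
  have ap1 : a p1 = 1 by rewrite /a eqxx.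
  have ap2 : a p2 = r%:C%C by rewrite /a eq_sym p21.
  have d0 : 0 <= 6 * r by lra.
  have d12 : 6 * r <= 1 / 2 by lra.
  have r2 : r <= 1 / 2 by lra.
  have M1 := mean_taylor_le pgt0 sT C0 d0 d12 TC
    (fun t => near_one_sqr (c := a) t us (erefl G) (ltW r0) r2 _ _ _).
  have M2 := mean_taylor_le pgt0 sT C0 d0 d12 TC
    (fun t => near_one_sqr (c := fun q => e q * a q) t us (erefl G) (ltW r0) r2 _ _ _).
  rewrite !normcM !e1 !mul1r ap0 ap1 ap2 nr normc1 in M1 M2.
  have {}M1 := M1 erefl erefl erefl; have {}M2 := M2 erefl erefl erefl.
  rewrite (unconditional_Lp_eq a pgt0 uE GE e1) in M2.
  rewrite !big_ord_recr /= in M1 M2.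
  (* Minimality of the relation makes sums of fewer than [i + j] letters unique, so the lower
     moments ignore [e]. *)
  have lowE : \sum_(k < i + j) T`_k * wenergy k G (fun q => e q * a q) =
      \sum_(k < i + j) T`_k * wenergy k G a.
    apply: eq_bigr => k _; congr (_ * _).
    by apply: (wenergy_unimodular a (ijmin k (ltn_ord k)) GP).
  rewrite lowE in M2.
  (* The pair consists of the two sides of the shortest relation; [p2] occurs [j] times in [w1] and
     never in [w2], and the pair contributes [r ^+ (i + j)]. *)
  have [w1 [w1s w1c w1p]] : exists w : {ffun 'I_(i + j) -> G},
    [/\ wsum w = p1 *+ (i + j), wcount p2 w = j & wprod a w = (r ^+ (i + j))%:C%C].
    have sz : size (nseq i p0 ++ nseq j p2) = (i + j)%N by rewrite size_cat !size_nseq.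
    have sG : {in nseq i p0 ++ nseq j p2, forall q, q \in G}.
      move=> q; rewrite mem_cat !mem_nseq /G seq_fsetE !inE.
      by case/orP => /andP[_ ->]; rewrite ?orbT.
    have [w [ws wc wp]] := word_of_seq R sz sG; exists w; split.
    - by rewrite ws big_cat /= !big_nseq !iter_addr_0 ijE.
    - by rewrite wc count_cat !count_nseq /= p20 eqxx mul0n mul1n.
    - by rewrite wp big_cat /= !big_nseq !iter_mulr_1 ap0 ap2 -exprD rmorphXn.
  have [w2 [w2s w2c w2p]] : exists w : {ffun 'I_(i + j) -> G},
    [/\ wsum w = p1 *+ (i + j), wcount p2 w = 0%N & wprod a w = 1].
    have sz : size (nseq (i + j) p1) = (i + j)%N by rewrite size_nseq.
    have sG : {in nseq (i + j) p1, forall q, q \in G}.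
      move=> q; rewrite !mem_nseq /G seq_fsetE !inE.
      by case/andP => _ ->; rewrite ?orbT.
    have [w [ws wc wp]] := word_of_seq R sz sG; exists w; split.
    - by rewrite ws big_nseq iter_addr_0.
    - by rewrite wc count_nseq /= p21 mul0n.
    - by rewrite wp big_nseq iter_mulr_1 ap1 expr1n.
  have drop : wenergy (i + j) G (fun q => e q * a q) <=
      wenergy (i + j) G a - 2 * r ^+ (i + j).
    have := @wenergy_drop R (i + j) G a om p2 j (w1, w2) (fun q _ => a0 q) om1 omj.
    by rewrite /wterm /= w1s w2s w1c w2c w1p w2p conjc1 mulr1; apply.
  have rn : 0 < r ^+ (i + j) by rewrite exprn_gt0.
  move: M1 M2 drop; set S := \sum_(k < _) _; set M := mean _.
  set W1 := wenergy _ _ a; set W2 := wenergy _ _ _ => M1 M2 drop.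
  (* Both approximations share the mean [M] and the lower sum [S], so subtraction leaves only the
     top moments and two errors. *)
  have tri : `|T`_(i + j) * (W1 - W2)| <= 2 * (C * (6 * r) ^+ (i + j).+1).
    have -> : T`_(i + j) * (W1 - W2) =
      (M - (S + T`_(i + j) * W2)) - (M - (S + T`_(i + j) * W1)) by ring.
    apply: le_trans (ler_normB _ _) _; lra.
  have : `|T`_(i + j)| * (2 * r ^+ (i + j)) <= 2 * (C * (6 * r) ^+ (i + j).+1).
    apply: le_trans tri; rewrite normrM ler_wpM2l// ler_normr; apply/orP; left; lra.
  rewrite exprMn [r ^+ _.+1]exprS.
  rewrite (_ : _ * (2 * _) = 2 * r ^+ (i + j) * `|T`_(i + j)|); last by ring.
  rewrite (_ : 2 * (C * _) = 2 * r ^+ (i + j) * (C * 6 ^+ (i + j).+1 * r)); last by ring.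
  by rewrite ler_pM2l// mulr_gt0.
pose K := C * 6 ^+ (i + j).+1.
have K0 : 0 <= K by rewrite mulr_ge0// exprn_ge0.
(* With this [r] the product [K * r] is at most half the modulus of the top coefficient,
   contradicting [main]. *)
pose r := Num.min (1 / 12) (`|T`_(i + j)| / (2 * (K + 1))).
have T0 : 0 < `|T`_(i + j)| by rewrite normr_gt0.
have K1 : 0 < 2 * (K + 1) by lra.
have r0 : 0 < r by rewrite lt_min; apply/andP; split; [lra|exact: divr_gt0].
have r12 : r <= 1 / 12 by rewrite ge_min lexx.
have rK : r * (2 * (K + 1)) <= `|T`_(i + j)|.
  by rewrite -ler_pdivlMr// ge_min lexx orbT.
have := main r r0 r12; rewrite -/K; nra.
Qed.

End three_elements_Lp.

(** * Even exponents *)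

Section even_exponent.
Variables (R : realType) (n : nat).
Hypothesis n0 : (0 < n)%N.
Implicit Types (a eps : int -> R[i]) (E : set int).

Lemma Lp_norm_even_le (C : R) (G : {fset int}) a b : 0 <= C ->
  (Lp_norm ((2 * n)%N%:R : R) (trig_sum G a) <=
     C%:E * Lp_norm ((2 * n)%N%:R : R) (trig_sum G b))%E <->
  wenergy n G a <= C ^+ (2 * n) * wenergy n G b.
Proof.
move=> C0; have p0 : 0 < (2 * n)%N%:R :> R by rewrite ltr0n muln_gt0.
have wE c : mean (fun t => normc (trig_sum G c (expi t)) `^ (2 * n)%N%:R) =
    wenergy n G c.
  rewrite -mean_normc_trig_sumX; apply: eq_mean => t.
  by rewrite powR_mulrn ?normc_ge0.
by rewrite -(powR_mulrn _ C0) -!wE; exact: Lp_norm_le.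
Qed.

Lemma unique_sums_unconditional E : unique_sums n E ->
  one_unconditional (Lp_norm ((2 * n)%N%:R : R)) E.
Proof.
move=> uE G a eps GE eps1; apply/(Lp_norm_even_le _ _ _ ler01).
by rewrite (wenergy_unimodular a uE GE eps1) expr1n mul1r.
Qed.

(** With [M] the bound on the energy, a drop by 2 from a value at most [M] forces a ratio of at
    least [1 + 2 / M]; the root turns energies into norms. *)
Definition gap_constant : R :=
  (1 + 2 / ((2 * n) ^ (2 * n))%N%:R) `^ (2 * n)%N%:R^-1.

Lemma gap_constant_gt1 : 1 < gap_constant.
Proof.
have M0 : 0 < ((2 * n) ^ (2 * n))%N%:R :> R.
  by rewrite ltr0n expn_gt0 muln_gt0 n0.
have pV : 0 < (2 * n)%N%:R^-1 :> R by rewrite invr_gt0 ltr0n muln_gt0.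
have d0 : 0 < 2 / ((2 * n) ^ (2 * n))%N%:R :> R by rewrite divr_gt0.
have one : 1 `^ (2 * n)%N%:R^-1 = 1 :> R by rewrite powR1.
rewrite -[ltLHS]one.
by apply: gt0_ltr_powR => //; rewrite ?nnegrE; lra.
Qed.

Lemma gap_constantX :
  gap_constant ^+ (2 * n) = 1 + 2 / ((2 * n) ^ (2 * n))%N%:R.
Proof.
have M0 : 0 <= 1 + 2 / ((2 * n) ^ (2 * n))%N%:R :> R.
  by rewrite addr_ge0// divr_ge0.
rewrite -powR_mulrn ?powR_ge0// -powRrM mulVf ?powRr1//.
by rewrite pnatr_eq0 -lt0n muln_gt0.
Qed.

(** The constant is tested on the coefficients of lowered energy, with the inverse factors restoring
    the coefficients 1. *)
Lemma not_unique_sums_gap E C : ~ unique_sums n E -> 0 <= C ->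
  unconditional_with (Lp_norm ((2 * n)%N%:R : R)) E C -> gap_constant <= C.
Proof.
move=> nE C0 uC.
have [G [eps [GE eps1 drop bound]]] := not_unique_sums_drop R nE.
have epsV1 q : q \in G -> normc (eps q)^-1 = 1.
  by move=> /eps1 e1; rewrite normcV e1 invr1.
have := uC G (fun q => eps q * 1) _ GE epsV1.
move=> /(Lp_norm_even_le _ _ _ C0).
have -> : wenergy n G (fun q => (eps q)^-1 * (eps q * 1)) = wenergy n G (fun=> 1).
  have eK (j : G) : (eps (val j))^-1 * (eps (val j) * 1) = 1.
    by rewrite mulKf//; exact/unimodular_neq0/eps1/valP.
  have wK (w : {ffun 'I_n -> G}) :
      wprod (fun q => (eps q)^-1 * (eps q * 1)) w = wprod (fun=> 1) w.
    by apply: eq_bigr => j _; rewrite eK.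
  by apply: eq_bigr => u _; rewrite /wterm !wK.
have W0 : 0 <= wenergy n G (fun q => eps q * 1).
  rewrite -mean_normc_trig_sumX; apply: mean_ge0 => t.
  by rewrite exprn_ge0 ?normc_ge0.
move=> WKV.
rewrite -(ler_pXn2r (n := 2 * n)) ?nnegrE ?powR_ge0 ?muln_gt0// gap_constantX.
move: WKV drop bound W0; set W := wenergy n G (fun=> 1); set V := wenergy n G _.
have K0 : 0 <= C ^+ (2 * n) by exact: exprn_ge0.
move: (C ^+ _) K0 => K K0.
have M0 : 0 < ((2 * n) ^ (2 * n))%N%:R :> R.
  by rewrite ltr0n expn_gt0 muln_gt0 n0.
move: (((2 * n) ^ (2 * n))%N%:R) M0 => M M0 WKV VW WM V0.
rewrite leNgt; apply/negP => KM.
have W2 : 0 <= W - 2 by apply: le_trans V0 VW.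
have WK : W <= K * (W - 2) by apply: le_trans WKV _; rewrite ler_wpM2l.
(* A gain of at least 2 from [W - 2] to [K * (W - 2)] is impossible under this bound, as
   [W - 2 < M]. *)
have : (K - 1) * M < 2.
  by rewrite -ltr_pdivlMr//; lra.
nra.
Qed.

End even_exponent.

Theorem proposition3p2p1 (R : realType) :
  (* (i) *)
  (forall E : set int,
    (forall p : R, 1 <= p -> (forall k : int, p <> (2 * k)%:~R) ->
      (one_unconditional (Lp_norm p) E <-> (E #<= `I_2)%card)) /\
    (one_unconditional (@sup_norm R) E <-> (E #<= `I_2)%card)) /\
  (* (ii) *)
  (forall p : nat, (2 <= p)%N -> ~~ odd p ->
    (forall E : set int,
      one_unconditional (Lp_norm (p%:R : R)) E <-> independent p./2 E) /\
    (exists Cp : R, 1 < Cp /\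
      forall E : set int,
        one_unconditional (Lp_norm (p%:R : R)) E \/
        (Cp%:E <= unconditionality_constant (Lp_norm (p%:R : R)) E)%E)).
Proof.
split=> [E|p p2 podd].
  split=> [p p1 pN|]; split=> [uE|/card_le2P[q0 [q1 [q01 Eq]]]].
  - apply/card_le2P.
    have [//|[p0 [p1' [p2 [p01 p12 E0 E1 E2]]]]] := card_le2_or_three E.
    by case: (Lp_norm_three p1 pN p01 p12 E0 E1 E2 uE).
  - exact: (two_elements_Lp p1 q01 Eq).
  - apply/card_le2P.
    have [//|[p0 [p1' [p2 [p01 p12 E0 E1 E2]]]]] := card_le2_or_three E.
    by case: (sup_norm_three p01 p12 E0 E1 E2 uE).
  - exact: (two_elements_sup q01 Eq).
have pE : p = (2 * p./2)%N by rewrite mul2n even_halfK.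
have n0 : (0 < p./2)%N by rewrite half_gt0.
rewrite {1 3 4}pE; move: (p./2) n0 => n n0 {p p2 podd pE}.
have gap E : ~ unique_sums n E -> forall C, 0 <= C ->
    unconditional_with (Lp_norm ((2 * n)%N%:R : R)) E C -> gap_constant R n <= C.
  by move=> nE C C0 uC; exact: not_unique_sums_gap uC.
split=> [E|].
  split=> [uE|/independent_unique_sums]; last exact: unique_sums_unconditional.
  apply: unique_sums_independent; apply: contrapT => nE.
  (* Constant 1 would bound the gap constant by 1. *)
  have := gap E nE 1 ler01 uE; apply/negP; rewrite -ltNge.
  exact: gap_constant_gt1.
exists (gap_constant R n); split; first exact: gap_constant_gt1.
move=> E; have [uE|nE] := pselect (unique_sums n E).
  by left; exact: unique_sums_unconditional.
right; apply: le_ereal_inf_tmp => _ [C [C0 uC] <-]; rewrite lee_fin.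
exact: gap nE C C0 uC.
Qed.
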